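(* Let $G$ be a planar graph with $\sigma=\sigma(G)\ge 5$, $\sigma\ge \Delta(G)+2$ and girth at least $5\sigma+16$. Then $\chi'_s(G)=\sigma$.
   Context: Graphs are finite and simple, and $\Delta(G)$ is the maximum degree. The girth is the length of a shortest cycle ($+\infty$ if there is none). A strong $k$-edge-coloring of $G$ is a map $E(G)\to\{1,\dots,k\}$ such that any two distinct edges at distance at most two (that is, sharing an endpoint, or joined by an edge of $G$ having one endpoint in each) receive different colors. The strong chromatic index $\chi'_s(G)$ is the minimum $k$ for which $G$ has a strong $k$-edge-coloring. For a graph $G$ with at least one edge, $\sigma(G)=\max_{xy\in E(G)}\{\deg(x)+\deg(y)-1\}$. *)

(* Defs.v *)
From HB Require Import structures.
From mathcomp Require Import all_boot all_order all_algebra.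
From mathcomp Require Import all_classical all_reals all_analysis.

Set Implicit Arguments.
Unset Strict Implicit.
Unset Printing Implicit Defensive.

Import Order.TTheory GRing.Theory Num.Theory.
Import numFieldNormedType.Exports.

Local Open Scope classical_set_scope.
Local Open Scope ring_scope.

Record sgraph := SGraph {
  vertex :> finType;
  adj : rel vertex;
  adj_sym : symmetric adj;
  adj_irr : irreflexive adj }.

Section Graph.
Variable G : sgraph.
Implicit Types x y : G.

Definition edges : {set {set G}} :=
  [set e : {set G} | [exists x, exists y, adj x y && (e == [set x; y])]]%SET.

Definition edge := {e : {set G} | e \in edges}.

Definition deg x : nat := #|[set y | adj x y]%SET|.

Definition maxdeg : nat := (\max_(x : G) deg x)%N.

(* Only meaningful when G has at least one edge; otherwise the value is 0. *)
Definition sigma : nat :=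
  (\max_(p : G * G | adj p.1 p.2) (deg p.1 + deg p.2 - 1))%N.

(* At least three vertices: ucycle also accepts x y x as a closed walk. *)
Definition is_cycle (c : seq G) : bool := (2 < size c)%N && ucycleb (@adj G) c.

(* The infimum of the empty set is +oo. *)
Definition girth (R : realType) : \bar R :=
  ereal_inf [set ((size c)%:R)%:E | c in [set c | is_cycle c]].

Definition within_distance2 (e1 e2 : edge) : bool :=
  [exists x in val e1, exists y in val e2, (x == y) || adj x y].

Definition strong_coloring (k : nat) (f : {ffun edge -> 'I_k}) : bool :=
  [forall e1, forall e2,
     (e1 != e2) && within_distance2 e1 e2 ==> (f e1 != f e2)].

Definition strong_colorable (k : nat) : bool :=
  [exists f : {ffun edge -> 'I_k}, strong_coloring f].

Lemma ex_strong_colorable : exists k, strong_colorable k.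
Proof.
exists #|{: edge}|; apply/existsP; exists [ffun e => enum_rank e].
apply/forallP => e1; apply/forallP => e2; apply/implyP => /andP[ne _].
by rewrite !ffunE (inj_eq enum_rank_inj).
Qed.

Definition strong_chromatic_index : nat := ex_minn ex_strong_colorable.

(* A drawing in the plane: p places the vertices, and a e, restricted to     *)
(* [0, 1], is a simple arc joining the two ends of the edge e, in either     *)
(* direction. Arcs may meet vertices and one another only at their ends.     *)
Definition planar (R : realType) : Prop :=
  exists (p : G -> R * R) (a : edge -> R -> R * R),
  [/\ injective p,
      forall e, [/\ {within `[0, 1], continuous (a e)},
                    {in `[0, 1] &, injective (a e)}
                  & [set a e 0; a e 1] = p @` [set x | x \in val e]],
      forall e x, ~ (a e @` `]0, 1[) (p x)
    & forall e1 e2 : edge, e1 != e2 -> a e1 @` `]0, 1[ `&` a e2 @` `]0, 1[ = set0].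

End Graph.

(* Main.v *)
(** If [x] and [y] are adjacent, the [deg x + deg y - 1] edges at [x] or [y]
    pairwise conflict, so [sigma] colours are necessary.

    For the converse, edges are coloured by induction on their number. A vertex
    with pendant neighbours and at most one other neighbour is harmless: its
    pendant edges are coloured last. Otherwise the graph without its pendant
    vertices has minimum degree 2 and contains a thread, that is [n = sigma + 3]
    consecutive vertices of degree 2. Remove the edges at these vertices, colour
    the rest, and let [S_i] be the set of colours wanted at the [i]-th vertex of
    the thread. What is needed is that [S_i] and [S_(i+1)] share only the colour
    of the edge between them. When consecutive degrees add up to [sigma + 1], two
    steps along the thread exchange one colour of [S_i] for a colour outside, and
    the thread is long enough to exchange all colours that have to be exchanged.
    If there is slack, some colours can be set aside so that the others are in
    the tight situation.

    Threads come from planarity in an algebraic way that avoids the Jordan curve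
    theorem. After rounding the drawing to a fine grid, every grid square [p]
    gives a linear form on the cycle space over F_2, namely the parity of the
    crossings of a cycle with a ray from [p]. This form changes across an edge [e]
    by the coordinate form of [e]. Hence each edge borders at most two forms, the
    edges bordering a given form make up an even subgraph, and there are at least
    [E - V + 2] forms with nonempty border. An even subgraph contains a cycle,
    which has length at least [5 n + 1], so without threads it passes through at
    least six vertices of degree 3 or more; a count of these incidences is then
    contradictory. *)

From mathcomp Require Import all_boot all_order all_algebra.
From mathcomp Require Import zify.

Set Implicit Arguments.
Unset Strict Implicit.
Unset Printing Implicit Defensive.

(** * Extending a strong colouring along a path *)

(* Membership hypotheses make [lia] very slow. *)
Ltac slia :=
  repeat match goal with
  | H : is_true (@in_mem _ _ _) |- _ => clear H
  | H : is_true (~~ (@in_mem _ _ _)) |- _ => clear H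
  end; lia.

Section ColorSets.
Variable K : finType.
Implicit Types A B S T U V : {set K}.

Lemma card_gt0_pick A : 0 < #|A| -> exists x, x \in A.
Proof. by rewrite card_gt0 => /set0Pn. Qed.

Lemma card_gt1_pick A f : 1 < #|A| -> exists2 x, x \in A & x != f.
Proof.
move=> cA; have : 0 < #|A :\ f| by rewrite (cardsD1 f) in cA; slia.
by case/card_gt0_pick => x; rewrite !inE => /andP[? ?]; exists x.
Qed.

Lemma card_gt2_pick A f g : 2 < #|A| -> exists x, [/\ x \in A, x != f & x != g].
Proof.
move=> cA; have : 1 < #|A :\ g| by rewrite (cardsD1 g) in cA; slia.
by case/(card_gt1_pick f) => x; rewrite !inE => /andP[? ?] ?; exists x.
Qed.

Lemma subset_of_card A n : n <= #|A| -> exists2 B : {set K}, B \subset A & #|B| = n.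
Proof.
elim: n => [|n IH] hn; first by exists set0; rewrite ?cards0 ?sub0set.
have [B BA cB] := IH (ltnW hn).
have : 0 < #|A :\: B| by rewrite cardsD (setIidPr BA); slia.
case/card_gt0_pick=> x; rewrite inE => /andP[xB xA].
exists (x |: B); last by rewrite cardsU1 xB cB.
by rewrite subUset sub1set xA.
Qed.

Lemma card_swap S x y : y \in S -> x \notin S -> #|x |: (S :\ y)| = #|S|.
Proof. by move=> yS xS; rewrite cardsU1 !inE (negbTE xS) andbF (cardsD1 y S) yS. Qed.

Lemma card_swapD S T x y : y \in S -> x \notin S ->
  #|(x |: (S :\ y)) :\: T| + (y \notin T) = #|S :\: T| + (x \notin T).
Proof.
move=> yS xS.
have -> : (x |: (S :\ y)) :\: T = ([set x] :\: T) :|: ((S :\: T) :\ y).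
  by apply/setP => z; rewrite !inE; do ![case: (_ == _) | case: (_ \in _)].
rewrite cardsU (_ : _ :&: _ = set0) ?cards0; last first.
  apply/setP => z; rewrite !inE; case: eqP => [->|] //=; first by rewrite (negbTE xS) !andbF.
  by rewrite andbF.
rewrite (cardsD1 y (S :\: T)) !inE yS andbT.
have -> : #|[set x] :\: T| = (x \notin T).
  case: (boolP (x \in T)) => xT.
    by rewrite (_ : _ :\: _ = set0) ?cards0 //; apply/eqP; rewrite setD_eq0 sub1set.
  by rewrite (_ : _ :\: _ = [set x]) ?cards1 //; apply/setDidPl; rewrite disjoints1.
lia.
Qed.

Lemma card_swapDr S T x y : y \in S -> x \notin S -> #|S| = #|T| ->
  #|T :\: (x |: (S :\ y))| + (y \notin T) = #|T :\: S| + (x \notin T).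
Proof.
move=> yS xS eST; have := card_swapD T yS xS; have := card_swap yS xS.
move: (x |: _) => S' eS'; have := cardsID T S; have := cardsID S T.
have := cardsID T S'; have := cardsID S' T; rewrite !(setIC T).
lia.
Qed.

(* Walks of [h] moves in the Johnson graph of the subsets of [U]. Each move
   exchanges [y] for [x]; the element [f] entered last may not leave at once,
   and the last one to enter must not be [g]. *)
Fixpoint jwalk U h S f T g : Prop :=
  if h is h'.+1 then
    exists y x, [/\ y \in S, y != f, x \in U :\: S & jwalk U h' (x |: (S :\ y)) x T g]
  else S = T /\ f != g.

(** Every move brings in an element of [T] and drops one outside [T], so an element that has just
    entered never has to leave. The hypotheses on [f] and [g] settle the first and the last move. *)
Lemma jwalk_direct U h S f T g : S \subset U -> T \subset U -> #|S| = #|T| ->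
  #|S :\: T| = h -> f \notin S :\: T -> g \notin T :\: S -> (0 < h) || (f != g) ->
  jwalk U h S f T g.
Proof.
elim: h S f => [|h IH] S f SU TU eST cST fn gn hfg /=.
  split=> //; apply/eqP; rewrite eqEcard eST leqnn andbT.
  by rewrite -setD_eq0 -cards_eq0 cST.
have cTS : #|T :\: S| = h.+1.
  by have := cardsID T S; have := cardsID S T; rewrite (setIC T); slia.
have [y] : exists y, y \in S :\: T by apply: card_gt0_pick; slia.
have [x] : exists x, x \in T :\: S by apply: card_gt0_pick; slia.
move=> xTS yST; have := xTS; have := yST; rewrite !inE => /andP[yT yS] /andP[xS xT].
exists y, x; split=> //.
- by apply: contraNneq fn => <-.
- by rewrite !inE xS (subsetP TU).
apply: IH => //.
- rewrite subUset sub1set (subsetP TU) //=; apply: subset_trans SU; exact: subsetDl.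
- by rewrite card_swap.
- by have := card_swapD T yS xS; rewrite yT xT; slia.
- by rewrite in_setD xT.
- apply: contra gn; rewrite !inE negb_or negb_and negbK => /andP[/andP[_ gS] gT].
  rewrite gT andbT; case/orP: gS => [/eqP gy|//].
  by move: gT; rewrite gy (negbTE yT).
- by apply/orP; right; apply: contraNneq gn => <-.
Qed.

Lemma swap_sub U S x y : S \subset U -> x \in U -> x |: (S :\ y) \subset U.
Proof.
move=> SU xU; rewrite subUset sub1set xU; apply: subset_trans SU; exact: subsetDl.
Qed.

(** A first move that spares [f] and brings in [g], if [g] is still missing, leaves at least one
    move for [jwalk_direct]. *)
Lemma jwalk_ge2 U h S f T g : S \subset U -> T \subset U -> #|S| = #|T| ->
  #|S :\: T| = h -> 1 < h -> jwalk U h S f T g.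
Proof.
case: h => // h SU TU eST cST h1.
have cTS : #|T :\: S| = h.+1.
  by have := cardsID T S; have := cardsID S T; rewrite (setIC T); slia.
have [y yST yf] : exists2 y, y \in S :\: T & y != f by apply: card_gt1_pick; slia.
have [x xTS xg] : exists2 x, x \in T :\: S & (g \in T :\: S) ==> (x == g).
  case: (boolP (g \in T :\: S)) => gTS; first by exists g; rewrite ?eqxx ?implybT.
  have [x xTS] : exists x, x \in T :\: S by apply: card_gt0_pick; slia.
  by exists x; rewrite ?(negbTE gTS).
have := xTS; have := yST; rewrite !inE => /andP[yT yS] /andP[xS xT].
exists y, x; split=> //; first by rewrite !inE xS (subsetP TU).
apply: jwalk_direct => //.
- by apply: swap_sub => //; exact: (subsetP TU).
- by rewrite card_swap.
- by have := card_swapD T yS xS; rewrite yT xT; slia.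
- by rewrite in_setD xT.
- apply/negP; rewrite in_setD => /andP[gS' gT].
  have gTS : g \in T :\: S.
    rewrite inE gT andbT; apply: contra gS' => gS; rewrite !inE gS andbT.
    by apply/orP; right; apply: contraNneq yT => <-.
  by move: xg; rewrite gTS /= => /eqP xg; move: gS'; rewrite xg !inE eqxx.
- by apply/orP; left; slia.
Qed.

(** Spare moves are spent by keeping or increasing the distance to [T]. The last hypothesis excludes
    a real obstruction: in a five-element [U], three moves do not lead from [{1, 2, 3}] to
    [{1, 4, 5}] when [f = g = 1]. *)
Lemma jwalk_exists U h S f T g : S \subset U -> T \subset U -> #|S| = #|T| ->
  2 < #|S| -> #|S| + 2 <= #|U| -> #|S :\: T| <= h ->
  (2 <= #|S :\: T|) || (3 <= h) -> (1 <= #|S :\: T|) || (4 <= h) ->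
  [|| 6 <= #|U|, #|S :\: T| != 2, h != 3 | f != g] ->
  jwalk U h S f T g.
Proof.
elim: h S f => [|h IH] S f SU TU eST cS cU ht c2 c1 c6; first by slia.
have cTS : #|T :\: S| = #|S :\: T|.
  by have := cardsID T S; have := cardsID S T; rewrite (setIC T); slia.
have cSU : #|U :\: S| = #|U| - #|S| by rewrite cardsD (setIidPr SU).
have cI := cardsID T S.
have cTU : #|U :\: (S :|: T)| = #|U| - #|S| - #|S :\: T|.
  rewrite cardsD (setIidPr _) ?subUset ?SU //.
  by have := cardsUI S T; slia.
have step y x : y \in S -> y != f -> x \in U :\: S ->
    (#|x |: (S :\ y)| = #|S| -> x |: (S :\ y) \subset U ->
     #|(x |: (S :\ y)) :\: T| + (y \notin T) = #|S :\: T| + (x \notin T) ->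
     jwalk U h (x |: (S :\ y)) x T g) -> jwalk U h.+1 S f T g.
  move=> yS yf xUS IHj; exists y, x; split=> //.
  move: xUS; rewrite inE => /andP[xS xU].
  by apply: IHj; rewrite ?card_swap ?card_swapD ?swap_sub.
case: (ltngtP (#|S :\: T|) h.+1) => [htlt||hteq]; [|slia|]; last first.
  by apply: jwalk_ge2 => //; slia.
case t3 : (3 <= #|S :\: T|).
  have [y] : exists2 y, y \in S :\: T & y != f by apply: card_gt1_pick; slia.
  have [x] : exists x, x \in T :\: S by apply: card_gt0_pick; slia.
  rewrite !inE => /andP[xS xT] /andP[yT yS] yf.
  apply: (step y x) => //; first by rewrite inE xS (subsetP TU).
  move=> cS' S'U; rewrite xT yT /= => ct; have {}ct : #|(x |: S :\ y) :\: T| = #|S :\: T| - 1 by slia.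
  (* At least three elements of [T] lie outside [S], so [U] has six elements and the exceptional
     case cannot arise later. *)
  have cTSU : #|T :\: S| <= #|U :\: S| by rewrite subset_leq_card ?setSD.
  by apply: IH => //; rewrite ?cS' //; slia.
case: (ltngtP (#|S :\: T|) 2) => [tlt|tgt|teq]; last 1 first.
- case: (ltngtP h 2) => [hlt|hgt|heq]; first slia.
    have [y] : exists2 y, y \in S :\: T & y != f by apply: card_gt1_pick; slia.
    have [x] : exists x, x \in T :\: S by apply: card_gt0_pick; slia.
    rewrite !inE => /andP[xS xT] /andP[yT yS] yf.
    apply: (step y x) => //; first by rewrite inE xS (subsetP TU).
    move=> cS' S'U; rewrite xT yT /= => ct.
    by apply: IH => //; rewrite ?cS' //; slia.
  case q3 : (3 <= #|U| - #|S|).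
    have [y] : exists2 y, y \in S :\: T & y != f by apply: card_gt1_pick; slia.
    have [x] : exists x, x \in U :\: (S :|: T) by apply: card_gt0_pick; slia.
    rewrite !inE negb_or => /andP[/andP[xS xT] xU] /andP[yT yS] yf.
    apply: (step y x) => //; first by rewrite inE xS xU.
    move=> cS' S'U; rewrite (negbTE xT) yT /= => ct.
    by apply: jwalk_ge2 => //; rewrite ?cS' //; slia.
  have [x] : exists x, x \in T :\: S by apply: card_gt0_pick; slia.
  rewrite !inE => /andP[xS xT].
  case: (boolP [exists z, (z \in S :&: T) && (z != f)]) => [/existsP[y]|/existsPn nex].
    rewrite inE => /andP[/andP[yS yT] yf].
    apply: (step y x) => //; first by rewrite inE xS (subsetP TU).
    move=> cS' S'U; rewrite xT yT /= => ct.
    by apply: jwalk_ge2 => //; rewrite ?cS' //; slia.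
  have [z zST] : exists z, z \in S :&: T by apply: card_gt0_pick; slia.
  have zf : z = f by have := nex z; rewrite zST /= negbK => /eqP.
  have c1ST : #|S :&: T| <= 1.
    rewrite leqNgt; apply/negP => /(card_gt1_pick f) [w wST wf].
    by have := nex w; rewrite wST wf.
  (* Now [f] is the only common element. It leaves at the second move and returns at the third, as
     [f != g] allows. *)
  have fg : f != g by slia.
  have [y] : exists y, y \in S :\: T by apply: card_gt0_pick; slia.
  move: zST; rewrite !inE => /andP[zS zT] /andP[yT yS].
  apply: (step y x) => //; first by rewrite -zf; apply: contraNneq yT => ->.
    by rewrite inE xS (subsetP TU).
  move=> cS' S'U; rewrite xT yT /= => ct.
  have zx : z != x by apply: contraNneq xS => <-.
  have zy : z != y by apply: contraNneq yT => <-.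
  have zS' : z \in x |: S :\ y by rewrite !inE zy zS orbT.
  have cTS' : #|T :\: (x |: S :\ y)| = 1.
    by have := card_swapDr yS xS eST; rewrite xT yT; slia.
  have [x2] : exists x2, x2 \in T :\: (x |: S :\ y) by apply: card_gt0_pick; slia.
  rewrite in_setD => /andP[x2S x2T].
  rewrite heq; exists z, x2; split=> //; first by rewrite inE x2S (subsetP TU).
  have cz := card_swapD T zS' x2S; rewrite zT x2T /= in cz.
  apply: jwalk_direct => //.
  - by apply: swap_sub => //; apply: (subsetP TU).
  - by rewrite card_swap ?cS'.
  - slia.
  - by rewrite in_setD x2T.
  apply/negP => gT.
  have := card_swapDr zS' x2S (etrans cS' eST); rewrite zT x2T cTS' /= => c1'.
  have zTS : z \in T :\: (x2 |: (x |: S :\ y) :\ z).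
    rewrite inE zT andbT !inE eqxx /= orbF.
    by apply: contraNneq x2S => <-.
  have : #|[set z; g]| <= #|T :\: (x2 |: (x |: S :\ y) :\ z)|.
    by apply: subset_leq_card; apply/subsetP => w; rewrite !in_set2 => /orP[]/eqP ->.
  have zg : z != g by rewrite zf.
  by rewrite cards2 zg; slia.
- case: (ltngtP (#|S :\: T|) 0) => [//|tpos|t0]; last first.
    have [y yS yf] : exists2 y, y \in S & y != f by apply: card_gt1_pick; slia.
    have [x xUS] : exists x, x \in U :\: S by apply: card_gt0_pick; slia.
    apply: (step y x) => // cS' S'U ct.
    have yT : y \in T.
      by apply: contra_eqT t0 => yT; rewrite -lt0n (cardsD1 y) !inE yS yT.
    have xT : x \notin T.
      move: xUS; rewrite inE => /andP[xS _]; apply: contra xS => xT.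
      apply: contra_eqT t0 => xS; rewrite -lt0n -cTS.
      by rewrite (cardsD1 x) !inE xS xT.
    by rewrite yT (negbTE xT) /= in ct; apply: IH => //; rewrite ?cS'; slia.
  have t1 : #|S :\: T| = 1 by slia.
  have [y] : exists2 y, y \in S :&: T & y != f by apply: card_gt1_pick; slia.
  rewrite !inE => /andP[yS yT] yf.
  case h3 : (h == 2).
    have [x] : exists x, x \in U :\: (S :|: T) by apply: card_gt0_pick; slia.
    rewrite !inE negb_or => /andP[/andP[xS xT] xU].
    apply: (step y x) => //; first by rewrite inE xS xU.
    move=> cS' S'U; rewrite (negbTE xT) yT /= => ct.
    by apply: jwalk_ge2 => //; rewrite ?cS' //; slia.
  have [x] : exists x, x \in T :\: S by apply: card_gt0_pick; slia.
  rewrite !inE => /andP[xS xT].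
  apply: (step y x) => //; first by rewrite inE xS (subsetP TU).
  move=> cS' S'U; rewrite xT yT /= => ct.
  by apply: IH => //; rewrite ?cS'; slia.
- by slia.
Qed.
End ColorSets.

(** * Flips along a tight path, and colours that are set aside *)

Section Flips.
Variable K : finType.
Implicit Types A B S T U V R RJ : {set K}.

(* [j] steps along a path with tight degrees: the colour sets of two neighbours
   cover [U], so the next set is the complement of [S] with the colour [y] of
   the common edge added. Two steps make one move of [jwalk]. *)
Fixpoint flips U j S f T g : Prop :=
  if j is j'.+1 then
    exists y, [/\ y \in S, y != f & flips U j' (y |: (U :\: S)) y T g]
  else S = T /\ f != g.

(** Flipping with the colour [y] and then with [x] turns [S] into [x |: (S :\ y)]. *)
Lemma jwalk_flips U h S f T g : S \subset U -> jwalk U h S f T g ->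
  flips U h.*2 S f T g.
Proof.
elim: h S f => [//|h IH] S f SU /= [y [x [yS yf xUS W]]].
move: (xUS); rewrite inE => /andP[xS xU].
exists y; split=> //; exists x; split.
- by rewrite !inE xS xU orbT.
- by apply: contraNneq xS => ->.
suff -> : x |: (U :\: (y |: (U :\: S))) = x |: (S :\ y).
  by apply: IH => //; apply: swap_sub.
apply/setP => z; rewrite !inE; case: (z == x) => //=.
have := subsetP SU z; case: (z \in S); case: (z \in U); case: (z == y) => //.
  by move/(_ isT).
Qed.

Lemma card_flip U S y : S \subset U -> y \in S -> #|y |: (U :\: S)| = (#|U| - #|S|).+1.
Proof. by move=> SU yS; rewrite cardsU1 !inE yS /= cardsD (setIidPr SU). Qed.

(** For even [j] this is [jwalk_exists] with [j./2] moves, at least four of them. For odd [j] a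
    first flip with a suitable colour [y] reduces to an even number of steps. *)
Lemma flips_exists U j S f T g : S \subset U -> T \subset U ->
  2 < #|S| -> #|S| + 2 <= #|U| -> #|T| = (if odd j then #|U|.+1 - #|S| else #|S|) ->
  #|U| <= j -> 6 < j -> flips U j S f T g.
Proof.
move=> SU TU cS cU cT Uj j6.
have cDS : #|U :\: S| = #|U| - #|S| by rewrite cardsD (setIidPr SU).
have jE := odd_double_half j.
case jo : (odd j) in cT jE.
  have cI : 0 < #|S :&: T|.
    have : #|S :|: T| <= #|U| by rewrite subset_leq_card ?subUset ?SU.
    by rewrite cardsU; slia.
  (* The flip leaves the distance [#|S :&: T| - (y \in T)]. It has to be positive since only three
     moves may remain, and at most [j./2]; the last clause avoids the exception in
     [jwalk_exists]. *)
  have [y [yS yf hy]] : exists y, [/\ y \in S, y != f &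
      [/\ 0 < #|S :&: T| - (y \in T), #|S :&: T| <= 1 \/ y \in T & #|S :&: T| <= 2 \/ y != g]].
    have cST := cardsID T S.
    case: (ltngtP (#|S :&: T|) 2) => [lt2|gt2|eq2].
    - have [y] : exists2 y, y \in S :\: T & y != f by apply: card_gt1_pick; slia.
      rewrite inE => /andP[yT yS] yf; exists y; split=> //.
      by rewrite (negbTE yT); split; [slia|left; slia|left; slia].
    - have [y []] := card_gt2_pick f g gt2.
      rewrite inE => /andP[yS yT] yf yg; exists y; split=> //.
      by rewrite yT; split; [slia|right|right].
    have [y] : exists2 y, y \in S :&: T & y != f by apply: card_gt1_pick; slia.
    rewrite inE => /andP[yS yT] yf; exists y; split=> //.
    by rewrite yT; split; [slia|right|left; slia].
  rewrite -jE add1n; exists y; split=> //.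
  have S'U : y |: (U :\: S) \subset U by rewrite subUset sub1set (subsetP SU) // subsetDl.
  have cS' := card_flip SU yS.
  have cTD : #|T :\: (y |: (U :\: S))| = #|S :&: T| - (y \in T).
    have -> : T :\: (y |: (U :\: S)) = (S :&: T) :\ y.
      apply/setP => z; rewrite !inE negb_or negb_and negbK.
      case: (z == y) => //=; have := subsetP TU z; case: (z \in T); rewrite ?andbF //.
      by move=> ->; rewrite // orbF.
    by rewrite (cardsD1 y (S :&: T)) inE yS /= addKn.
  have eST' : #|y |: (U :\: S)| = #|T| by rewrite cS' cT; slia.
  have cSD : #|(y |: (U :\: S)) :\: T| = #|S :&: T| - (y \in T).
    rewrite -cTD; have := cardsID T (y |: (U :\: S)).
    have := cardsID (y |: (U :\: S)) T; rewrite (setIC T); slia.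
  have le1 : #|S :&: T| <= #|S| by rewrite subset_leq_card ?subsetIl.
  have le2 : #|S :&: T| <= #|T| by rewrite subset_leq_card ?subsetIr.
  have yg : [|| 6 <= #|U|, #|S :&: T| - (y \in T) != 2, j./2 != 3 | y != g].
    case: hy => _ h2 [h3|->]; last by rewrite !orbT.
    have {}h2 : #|S :&: T| - (y \in T) <= 1 by case: h2 => [h2|->]; slia.
    by apply/or4P; apply: Or42; slia.
  have cle : #|S :&: T| - (y \in T) <= j./2.
    by case: hy => h1 [h2|h2] _; [case: (y \in T); slia | rewrite h2; slia].
  case: hy => h1 _ _.
  by apply: jwalk_flips => //; apply: jwalk_exists => //; rewrite ?cSD ?cS' //; slia.
rewrite -jE add0n.
have c1 : #|S :\: T| <= #|S| by rewrite subset_leq_card ?subsetDl.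
have c2 : #|T :\: S| <= #|U :\: S| by rewrite subset_leq_card ?setSD.
have c3 := cardsID T S; have := cardsID S T; rewrite (setIC T) => c4.
by apply: jwalk_flips => //; apply: jwalk_exists => //; slia.
Qed.

Lemma subset_of_card_with A B n : B \subset A -> #|B| <= n -> n <= #|A| ->
  exists S, [/\ B \subset S, S \subset A & #|S| = n].
Proof.
move=> BA Bn nA; have [|C CAB cC] := @subset_of_card _ (A :\: B) (n - #|B|).
  by rewrite cardsD (setIidPr BA); slia.
exists (B :|: C); rewrite subsetUl subUset BA (subset_trans CAB (subsetDl _ _)); split=> //.
rewrite cardsU cC (_ : B :&: C = set0) ?cards0; first by slia.
apply/eqP; rewrite -subset0; apply/subsetP => z; rewrite inE => /andP[zB].
by move/(subsetP CAB); rewrite inE zB.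
Qed.

(* Colours in [V] are never put on edges of the path; such a colour only has to
   avoid the colour sets of two consecutive vertices. *)
Fixpoint rchain V rs R0 RJ : Prop :=
  if rs is r :: rs' then
    exists R, [/\ R \subset V, R0 :&: R = set0, r <= #|R| & rchain V rs' R RJ]
  else R0 :&: RJ = set0.

Lemma rchain_rcons V rs r R0 R RJ : rchain V rs R0 R -> R \subset V -> r <= #|R| ->
  R :&: RJ = set0 -> rchain V (rcons rs r) R0 RJ.
Proof.
elim: rs R0 => [|r' rs IH] R0 /=; first by exists R.
by case=> R' [? ? ? ?] *; exists R'; split=> //; apply: IH.
Qed.

(** A position of size 0 cuts the chain in two. Up to it the sets are chosen from the left, each
    disjoint from its predecessor, and after it from the right. *)
Lemma rchain_exists V rs R0 RJ : R0 \subset V -> RJ \subset V ->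
  path (fun a b => a + b <= #|V|) #|R0| (rcons rs #|RJ|) ->
  0 \in #|R0| :: rcons rs #|RJ| -> rchain V rs R0 RJ.
Proof.
have pick A n : A \subset V -> #|A| + n <= #|V| ->
    exists R, [/\ R \subset V, A :&: R = set0 & #|R| = n].
  move=> AV cn; have [|R RVA cR] := @subset_of_card _ (V :\: A) n.
    by rewrite cardsD (setIidPr AV); slia.
  exists R; split=> //; first exact: subset_trans RVA (subsetDl _ _).
  apply/eqP; rewrite -subset0; apply/subsetP => z; rewrite inE => /andP[zA].
  by move/(subsetP RVA); rewrite inE zA.
elim: rs R0 => [|r rs IH] R0 R0V RJV /=.
  rewrite andbT !inE => _; rewrite !(eq_sym 0) !cards_eq0 => /orP[]/eqP ->.
    exact: set0I.
  exact: setI0.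
case/andP => cr pr; rewrite inE eq_sym cards_eq0; case/orP => [/eqP R00|z0]; last first.
  have [R [RV R0R cR]] := pick _ _ R0V cr.
  by exists R; rewrite R0R cR; split=> //; apply: IH; rewrite ?cR.
have {}pr : path (fun a b => a + b <= #|V|) #|R0| (rcons (r :: rs) #|RJ|) by rewrite /= cr.
change (rchain V (r :: rs) R0 RJ); move: (r :: rs) pr; clear r rs IH cr; rewrite {}R00 => {R0 R0V} rs.
elim/last_ind: rs RJ RJV => [|rs r IH] RJ RJV; first by rewrite /= set0I.
rewrite rcons_path last_rcons => /andP[pr cr].
have [R [RV RJR cR]] : exists R, [/\ R \subset V, RJ :&: R = set0 & #|R| = r].
  by apply: pick => //; rewrite addnC.
by apply: (rchain_rcons (R := R)); rewrite ?cR // 1?setIC //; apply: IH; rewrite ?cR.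
Qed.

(* Along a path whose successive vertices have the colour sets [S], ..., [T]:
   consecutive sets share exactly the colour of the edge between them, [f] is the
   colour of the edge before [S] and [g] that of the edge after [T]. *)
Fixpoint conn D S f T g : Prop :=
  if D is d :: D' then
    exists y S', [/\ S :&: S' = [set y], y != f, d <= #|S'| & conn D' S' y T g]
  else exists y, [/\ S :&: T = [set y], y != f & y != g].

Lemma flip_inter U V S y R R' : S \subset U -> y \in S -> R \subset V -> R' \subset V ->
  U :&: V = set0 -> R :&: R' = set0 ->
  (S :|: R) :&: ((y |: (U :\: S)) :|: R') = [set y].
Proof.
move=> SU yS RV R'V UV RR; apply/setP => z; rewrite !inE.
have := subsetP SU z; have := subsetP RV z; have := subsetP R'V z.
move/setP/(_ z): UV; move/setP/(_ z): RR; rewrite !inE.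
case: (eqVneq z y) => [->|_] /=; first by rewrite yS.
by do ![case: (_ \in _) => //=] => *; do ?[exfalso; auto].
Qed.

(** The parts of the colour sets inside [U] come from the flips, those inside [V] from the chain.
    Only the former contain the shared colours; their sizes alternate between [#|S|] and
    [#|U|.+1 - #|S|]. *)
Lemma conn_flips U V D rs S f T g R0 RJ : S \subset U -> T \subset U ->
  U :&: V = set0 -> R0 \subset V -> RJ \subset V ->
  flips U (size D).+1 S f T g -> rchain V rs R0 RJ -> size rs = size D ->
  (forall i, i < size D ->
     nth 0 D i <= nth 0 rs i + (if odd i then #|S| else #|U|.+1 - #|S|)) ->
  conn D (S :|: R0) f (T :|: RJ) g.
Proof.
move=> SU TU UV R0V RJV; elim: D rs S SU f R0 R0V => [|d D IH] [|r rs] //= S SU f R0 R0V.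
  move=> [y [yS yf [<- yg]]] RR _ _; exists y; split=> //.
  exact: flip_inter UV RR.
move=> [y [yS yf W]] [R [RV RR rR RC]] [es] hD.
have S'U : y |: (U :\: S) \subset U by rewrite subUset sub1set (subsetP SU) // subsetDl.
have leS := subset_leq_card SU.
exists y, ((y |: (U :\: S)) :|: R); split=> //; first exact: flip_inter UV RR.
- have := hD 0 isT; rewrite /= cardsU card_flip // (_ : _ :&: R = set0) ?cards0.
    by slia.
  apply/eqP; rewrite -subset0 -UV; exact: setISS.
- apply: (IH rs) => // i iD; have := hD i.+1 iD; rewrite /= card_flip //.
  by case: (odd i) => /=; slia.
Qed.
End Flips.

(** * Choice of the colours to exchange, and extension along a path *)

Section Extension.
Variable K : finType.
Implicit Types A B S T U V R RJ : {set K}.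

Lemma card_disjU A B : A :&: B = set0 -> #|A :|: B| = #|A| + #|B|.
Proof. by move=> AB; rewrite cardsU AB cards0 subn0. Qed.

Lemma pick_regions S T a b c d : a <= #|S :\: T| -> b <= #|T :\: S| ->
  c <= #|S :&: T| -> d <= #|~: (S :|: T)| ->
  exists U, [/\ #|U| = a + b + c + d, #|U :&: S| = a + c, #|U :&: T| = b + c
    & #|U :\: T| = a + d].
Proof.
move=> /subset_of_card[A sA <-] /subset_of_card[B sB <-].
move=> /subset_of_card[C sC <-] /subset_of_card[Z sZ <-].
have mA z : z \in A -> (z \in S) && (z \notin T).
  by move/(subsetP sA); rewrite inE andbC.
have mB z : z \in B -> (z \notin S) && (z \in T) by move/(subsetP sB); rewrite inE.
have mC z : z \in C -> (z \in S) && (z \in T) by move/(subsetP sC); rewrite inE.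
have mZ z : z \in Z -> (z \notin S) && (z \notin T).
  by move/(subsetP sZ); rewrite !inE negb_or.
have dj (X Y : {set K}) : (forall z, z \in X -> z \in Y -> false) -> X :&: Y = set0.
  move=> h; apply/setP => z; rewrite !inE; apply/negP => /andP[zX zY].
  by have := h z zX zY.
have AC : A :&: C = set0 by apply: dj => z /mA/andP[_ /negbTE h] /mC; rewrite h andbF.
have BC : B :&: C = set0 by apply: dj => z /mB/andP[/negbTE h _] /mC; rewrite h.
have AZ : A :&: Z = set0 by apply: dj => z /mA/andP[h _] /mZ; rewrite h.
have AB : A :&: B = set0 by apply: dj => z /mA/andP[h _] /mB; rewrite h.
have BZ : B :&: Z = set0 by apply: dj => z /mB/andP[_ h] /mZ; rewrite h andbF.
have CZ : C :&: Z = set0 by apply: dj => z /mC/andP[h _] /mZ; rewrite h.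
exists (A :|: B :|: C :|: Z); split.
- by rewrite !card_disjU // !setIUl ?AB ?AC ?AZ ?BC ?BZ ?CZ ?setU0.
- rewrite (_ : _ :&: S = A :|: C) ?card_disjU //; apply/setP => z; rewrite !inE.
  move: (mA z) (mB z) (mC z) (mZ z).
  by do ![case: (_ \in _) => //=] => *; do ?[exfalso; auto].
- rewrite (_ : _ :&: T = B :|: C) ?card_disjU //; apply/setP => z; rewrite !inE.
  move: (mA z) (mB z) (mC z) (mZ z).
  by do ![case: (_ \in _) => //=] => *; do ?[exfalso; auto].
- rewrite (_ : _ :\: T = A :|: Z) ?card_disjU //; apply/setP => z; rewrite !inE.
  move: (mA z) (mB z) (mC z) (mZ z).
  by do ![case: (_ \in _) => //=] => *; do ?[exfalso; auto].
Qed.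

Lemma argmin_upto (P : pred nat) (F : nat -> nat) J i0 : i0 <= J -> P i0 ->
  exists i, [/\ i <= J, P i & forall i', i' <= J -> P i' -> F i <= F i'].
Proof.
move=> i0J Pi0; pose o i (h : i <= J) : 'I_J.+1 := Ordinal (h : i < J.+1).
case: (@arg_minnP _ (o i0 i0J) (fun i => P i) (fun i => F i)) => // i Pi min.
by exists i; split=> //; [rewrite -ltnS|move=> i' h Pi'; apply: (min (o i' h))].
Qed.

(** Here [a], [b], [c], [z] are the sizes of the four regions cut out by [S] and its target, [e] is
    the parity of the path length, and [t + e], [t], [p1 - (t + e)], [q1 - t.+1] are the numbers of
    colours of [U] taken from them. The minima make the bounds on [t] consistent; [t] is the least
    value that [c] and [z] allow. *)
Lemma slack_numbers p q a b c z (e : bool) : 2 < p -> 2 < q ->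
  p <= a + c -> q <= b + z + 1 -> p <= b + c + e -> q + e <= a + z + 1 ->
  (if e then 0 < a else 0 < c) ->
  exists p1 q1 t, [/\ [/\ 2 < p1, p1 <= p, 2 < q1 & q1 <= q], p1 = p \/ q1 = q,
    [/\ t + e <= a, t <= b, t + e <= p1 & p1 - (t + e) <= c]
    & t < q1 /\ q1 - t.+1 <= z].
Proof.
move=> p3 q3 h1 h2 h3 h4 h5; exists (minn p (q - 1 + e + c)), (minn q (p + 1 + z - e)).
exists (maxn (minn p (q - 1 + e + c) - e - c) (minn q (p + 1 + z - e) - 1 - z)).
by move: h3 h4 h5; case: e => /= h3 h4 h5; split; try (by slia); split; slia.
Qed.

Lemma mkseq_cons (r : nat -> nat) n : mkseq r n.+1 = r 0 :: mkseq (fun i => r i.+1) n.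
Proof.
by rewrite /mkseq /= -(addn0 1) iotaDl -map_comp.
Qed.

(* Only the colours in a set [U] are ever exchanged. It is chosen so that the
   part of the colour sets inside [U] has constant sizes [p1], [q2] at even and
   odd positions, with [#|U| = p1 + q2 - 1]. One of [p1], [q2] is a minimum of the
   sizes, so the other colours are absent from some set [i0] or [i1], and what
   they do before and after that vertex can be chosen independently. *)
Lemma conn_meet D S f T g :
  path (fun a b => a + b <= #|K|.+1) #|S| (rcons D #|T|) ->
  all (fun d => 2 < d) (#|S| :: rcons D #|T|) ->
  S :&: T != set0 -> #|K| <= (size D).+1 -> 6 < (size D).+1 -> conn D S f T g.
Proof.
set J := (size D).+1; pose F := nth 0 (#|S| :: rcons D #|T|).
move=> /(pathP 0); rewrite size_rcons -/J => hs /(all_nthP 0).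
rewrite /= size_rcons -/J => h3 ST KJ J6.
have FJ : F J = #|T| by rewrite /F /= nth_rcons ltnn eqxx.
have F0 : F 0 = #|S| by [].
have FD i : i < size D -> F i.+1 = nth 0 D i by rewrite /F /= nth_rcons => ->.
have {}hs i : i < J -> F i + F i.+1 <= #|K|.+1 by move/hs.
have {}h3 i : i <= J -> 2 < F i by move=> iJ; apply: h3; rewrite ltnS.
have [i0 [i0J ei0 pmin]] := @argmin_upto (fun i => ~~ odd i) F J 0 isT isT.
have [i1 [i1J oi1 qmin]] := @argmin_upto odd F J 1 isT isT.
set p := F i0 in pmin *; set q := F i1 in qmin *.
(* A flip complements the set inside [U] up to one colour, so for odd [J] the set to compare [S]
   with is the complement of [T]. *)
pose Th := if odd J then ~: T else T.
have ccK (X : {set K}) : #|X| + #|~: X| = #|K| by rewrite cardsC.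
have cI (X Y : {set K}) := cardsID X Y.
have hJ1 : F (size D) + #|T| <= #|K|.+1 by rewrite -FJ; apply: hs; rewrite /J.
have hS1 := hs 0 isT; rewrite F0 in hS1.
have q1 : q <= F 1 by apply: qmin.
have pS : p <= #|S| by rewrite -F0; apply: pmin.
have cSU : #|Th :\: S| + #|~: (S :|: Th)| = #|~: S|.
  rewrite -(cardsID Th (~: S)); congr (_ + _).
    by apply: eq_card => z; rewrite !inE.
  by apply: eq_card => z; rewrite !inE negb_or andbC.
have cTU : #|S :\: Th| + #|~: (S :|: Th)| = #|~: Th|.
  rewrite -(cardsID S (~: Th)); congr (_ + _).
    by apply: eq_card => z; rewrite !inE andbC.
  by apply: eq_card => z; rewrite !inE negb_or.
have cS := cI Th S; have := cI S Th; rewrite (setIC Th) => cTh.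
have kS := ccK S; have kT := ccK Th.
have hT : if odd J then #|Th| = #|K| - #|T| /\ #|~: Th| = #|T| else #|Th| = #|T|.
  rewrite /Th; case: (odd J) => //; rewrite setCK; split=> //.
  by have := ccK T; slia.
have TK : #|T| <= #|K| by rewrite max_card.
have hTp : if odd J then q <= #|T| /\ p <= F (size D) else p <= #|T| /\ q <= F (size D).
  have := qmin (size D) (leqnSn _); have := pmin (size D) (leqnSn _).
  have := pmin J (leqnn _); have := qmin J (leqnn _); rewrite FJ /J /=.
  by case: (odd (size D)) => /= *; split; auto.
have hC : if odd J then 0 < #|S :\: Th| else 0 < #|S :&: Th|.
  rewrite /Th; case: (odd J); last by rewrite card_gt0.
  by rewrite setDE setCK card_gt0.
have [|||||||p1 [q2 [t [[p13 p1p q13 q1q] dec [h1 h2 h4 h5] [h6 h7]]]]] :=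
  @slack_numbers p q #|S :\: Th| #|Th :\: S| #|S :&: Th| #|~: (S :|: Th)| (odd J) => //.
- exact: h3.
- exact: h3.
- slia.
- slia.
- by case: (odd J) hT hTp => /= *; slia.
- by case: (odd J) hT hTp => /= *; slia.
have [U [cardU cardUS cardUT cardUT']] := pick_regions h1 h2 h5 h7.
have cardUST : #|U :&: T| = if odd J then q2 else p1.
  move: cardUT cardUT' h1 h4 h6; rewrite /Th; case: (odd J) => *; last by slia.
  by rewrite -(setCK T) -setDE; slia.
have {}cardU : #|U| = p1 + q2 - 1 by slia.
have {}cardUS : #|U :&: S| = p1 by slia.
have cardV : #|~: U| = #|K|.+1 - p1 - q2 by have := ccK U; slia.
pose r i := F i - (if odd i then q2 else p1).
have rle i : i <= J -> (if odd i then q2 else p1) <= F i.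
  move=> iJ; case: (boolP (odd i)) => oi; first by apply: leq_trans q1q _; apply: qmin.
  by apply: leq_trans p1p _; apply: pmin.
have rs i : i < J -> r i + r i.+1 <= #|~: U|.
  move=> iJ; have := hs i iJ; have := rle i (ltnW iJ); have := rle i.+1 iJ.
  by rewrite cardV /r /=; case: (odd i) => /=; slia.
have cR0 : #|S :\: U| = r 0.
  by rewrite /r /= F0; have := cI U S; rewrite setIC cardUS; slia.
have cRJ : #|T :\: U| = r J.
  by rewrite /r FJ; have := cI U T; rewrite setIC cardUST; slia.
have rE : #|S :\: U| :: rcons (mkseq (fun i => r i.+1) (size D)) #|T :\: U| = mkseq r J.+1.
  by rewrite mkseqS mkseq_cons cR0 cRJ.
rewrite -(setID S U) -(setID T U) !(setIC _ U).
have UU : U :&: ~: U = set0 by apply/setP => z; rewrite !inE andbN.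
apply: (@conn_flips _ U (~: U) D (mkseq (fun i => r i.+1) (size D))) => //.
- exact: subsetIl.
- exact: subsetIl.
- by rewrite setDE subsetIr.
- by rewrite setDE subsetIr.
- have cUK : p1 + q2 - 1 <= J by apply: leq_trans KJ; rewrite -cardU max_card.
  apply: flips_exists; rewrite -/J ?subsetIl ?cardUS ?cardU //; try by slia.
  by rewrite cardUST -/J; case: (odd J); slia.
- apply: rchain_exists; rewrite ?setDE ?subsetIr //.
    rewrite -!setDE; apply/(pathP 0) => i; rewrite size_rcons size_mkseq => iJ.
    rewrite -[nth 0 (rcons _ _) i]/(nth 0 (#|S :\: U| :: rcons (mkseq (fun i => r i.+1) (size D)) #|T :\: U|) i.+1).
    by rewrite rE !nth_mkseq ?rs // ltnS ltnW.
  (* The surplus [r] vanishes at [i0] if [p1 = p] and at [i1] if [q2 = q]: this is the zero that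
     [rchain_exists] asks for. *)
  rewrite -!setDE rE; apply/mapP; case: dec => dec.
    by exists i0; rewrite ?mem_iota //= /r (negbTE ei0) dec subnn.
  by exists i1; rewrite ?mem_iota //= /r oi1 dec subnn.
- by rewrite size_mkseq.
move=> i iD; rewrite nth_mkseq // cardUS cardU /r -FD //.
by have := rle i.+1; rewrite /J ltnS => /(_ (ltnW iD)); rewrite /=; case: (odd i) => /=; slia.
Qed.

(** If [S] and [T] are disjoint, the first set [S'] is chosen to contain a colour of [T], and
    [conn_meet] applies to the rest of the path. *)
Lemma conn_any d D S f T g :
  path (fun a b => a + b <= #|K|.+1) #|S| (d :: rcons D #|T|) ->
  all (fun d => 2 < d) (#|S| :: d :: rcons D #|T|) ->
  4 < #|K| -> #|K| < (size D).+1 -> conn (d :: D) S f T g.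
Proof.
have [k kE] : exists k, k = #|K| by eexists.
have ccS : #|S| + #|~: S| = k by rewrite kE cardsC.
rewrite -kE => hs h3 K5 KJ; case: (eqVneq (S :&: T) set0) => [ST|]; last first.
  by move=> ST; apply: conn_meet => //; rewrite -?kE //=; slia.
have := h3; rewrite /= all_rcons => /and4P[cS cd cT hD].
have := hs; rewrite /= => /andP[cSd hs'].
have [y yS yf] : exists2 y, y \in S & y != f by apply: card_gt1_pick; slia.
have [z zT] : exists z, z \in T by apply: card_gt0_pick; slia.
have [|||S' [yzS' S'S cS']] := @subset_of_card_with _ (y |: ~: S) [set y; z] d.
- rewrite subUset !sub1set !inE eqxx /=; apply/orP; right.
  by apply: contraTN zT => zS; apply: contraPN ST => zT /setP/(_ z); rewrite !inE zS zT.
- by rewrite cards2; case: (_ == _) => /=; slia.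
- by rewrite cardsU1 !inE yS /=; slia.
exists y, S'; split=> //.
- apply/setP => w; rewrite !inE.
  have := subsetP S'S w; rewrite !inE; case: (eqVneq w y) => [->|wy] /=.
    by rewrite yS (subsetP yzS') // !inE eqxx.
  by case: (w \in S); case: (w \in S') => //= /(_ isT).
- by rewrite cS'.
(* Disjoint [S] and [T] have at least three colours each; with six colours the shortened path is
   still long enough for [conn_meet]. *)
have cK6 : 5 < k.
  by have := subset_leq_card (_ : T \subset ~: S); rewrite subsets_disjoint setCK disjoint_sym -setI_eq0 ST eqxx => /(_ isT); slia.
apply: conn_meet; rewrite -?kE ?cS' //=; first by rewrite all_rcons cd cT.
- by apply/set0Pn; exists z; rewrite inE zT (subsetP yzS') // !inE eqxx orbT.
- by slia.
- by slia.
Qed.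

Lemma conn_funs D S f T g : conn D S f T g -> exists (Sf : nat -> {set K}) (c : nat -> K),
  [/\ Sf 0 = S, Sf (size D).+1 = T,
      forall i, i <= size D -> Sf i :&: Sf i.+1 = [set c i],
      forall i, i < size D -> nth 0 D i <= #|Sf i.+1|
    & [/\ forall i, i < size D -> c i != c i.+1, c 0 != f & c (size D) != g]].
Proof.
elim: D S f => [|d D IH] S f /=.
  case=> y [STy yf yg]; exists (fun i => if i is 0 then S else T), (fun=> y).
  by split=> // -[].
case=> y [S' [SS' yf dS' /IH[Sf [c [S0 ST hI hd [hc c0 cg]]]]]].
exists (fun i => if i is i'.+1 then Sf i' else S), (fun i => if i is i'.+1 then c i' else y).
split=> //.
- by case=> [_|i] /=; [rewrite S0 | exact: hI].
- by case=> [_|i] /=; [rewrite S0 | exact: hd].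
by split=> //; case=> [_|i] /=; [rewrite eq_sym | exact: hc].
Qed.

(** The sets next to the two ends are chosen first, subject only to [S0] and [SN]; [conn_any] joins
    them across the remaining [k + 1] vertices. This determines the length of a thread. *)
Lemma path_extension k S0 (SN : {set K}) c0 cN (d : nat -> nat) :
  #|K| = k -> 4 < k -> c0 \in S0 -> cN \in SN ->
  #|S0| + 2 <= k -> #|SN| + 2 <= k -> #|S0| + d 1 <= k.+1 -> d k.+3 + #|SN| <= k.+1 ->
  (forall i, 0 < i -> i <= k.+3 -> d i + 2 <= k) ->
  (forall i, 0 < i -> i < k.+3 -> d i + d i.+1 <= k.+1) ->
  exists (S : nat -> {set K}) (c : nat -> K),
  [/\ S 0 = S0 /\ S k.+4 = SN, c 0 = c0 /\ c k.+3 = cN,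
      forall i, i < k.+4 -> S i :&: S i.+1 = [set c i],
      forall i, i < k.+3 -> c i != c i.+1
    & forall i, 0 < i -> i <= k.+3 -> d i <= #|S i|].
Proof.
move=> kE k5 c0S cNS cS0 cSN hd1 hdN hd2 hds.
(* Sizes are raised to 3 as [conn_any] requires. The sum conditions survive because each [d i] is at
   most [k - 2] and [k] is at least 5. *)
pose D i := maxn 3 (d i).
have side (S : {set K}) c j : c \in S -> #|S| + 2 <= k -> #|S| + d j <= k.+1 -> d j + 2 <= k ->
    exists S', [/\ S :&: S' = [set c] & #|S'| = D j].
  move=> cS cSk cSd dj.
  have [|||S' [cS' sS' eS']] := @subset_of_card_with _ (c |: ~: S) [set c] (D j).
  - by rewrite sub1set !inE eqxx.
  - by rewrite cards1 /D; slia.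
  - rewrite cardsU1 !inE cS /= /D.
    have ccS : #|S| + #|~: S| = k by rewrite -kE cardsC.
    by slia.
  exists S'; split=> //; apply/setP => z; rewrite !inE; have := subsetP sS' z.
  rewrite !inE; case: (eqVneq z c) => [->|_] /=; first by rewrite cS (subsetP cS') ?inE.
  by case: (z \in S); case: (z \in S') => //= /(_ isT).
have [S1 [S01 cS1]] := side S0 c0 1 c0S cS0 hd1 (hd2 1 isT isT).
have [T1 [T01 cT1]] : exists S', [/\ SN :&: S' = [set cN] & #|S'| = D k.+3].
  by apply: side => //; [rewrite addnC | apply: hd2].
have c0S1 : c0 \in S1 by have : c0 \in S0 :&: S1; [rewrite S01 inE | rewrite inE => /andP[]].
have hDs i : 0 < i -> i < k.+3 -> D i + D i.+1 <= k.+1.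
  move=> i0 ik; have := hds i i0 ik; have := hd2 i i0 (ltnW ik); have := hd2 i.+1 isT ik.
  by rewrite /D; slia.
have [||||Sf [c [Sf0 SfT hI hd [hc hc0 hcg]]]] :=
  conn_funs (@conn_any (D 2) (mkseq (fun i => D i.+3) k) S1 c0 T1 cN _ _ _ _).
- have E : rcons (D 2 :: mkseq (fun i => D i.+3) k) (D k.+3) = mkseq (fun i => D i.+2) k.+2.
    by rewrite mkseqS mkseq_cons.
  rewrite -rcons_cons cT1 cS1 E; apply/(pathP 0) => i; rewrite size_mkseq => ik.
  rewrite -[D 1 :: _](mkseq_cons (fun i => D i.+1)) !nth_mkseq ?kE ?ltnS //; last exact: leqW.
  exact: hDs.
- rewrite /= cS1 cT1 all_rcons; apply/and4P; split; rewrite /D ?leq_max //.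
  by apply/allP => x /mapP[i _ ->]; rewrite leq_max.
- by rewrite kE.
- by rewrite size_mkseq kE.
rewrite /= size_mkseq in SfT hI hd hc hcg.
exists (fun i => if i is i'.+1 then (if i' <= k.+2 then Sf i' else SN) else S0).
exists (fun i => if i is i'.+1 then (if i' <= k.+1 then c i' else cN) else c0).
rewrite /= !ltnn; split=> //.
- case=> [_|i] /=; first by rewrite Sf0.
  move=> ik; have {}ik : i <= k.+2 by []; rewrite ik.
  case: (ltngtP i k.+2) => [ik'|ik'|->].
  + by have {}ik' : i <= k.+1 by []; rewrite ik' hI.
  + by slia.
  + by rewrite ltnn SfT setIC.
- case=> [_|i] /=; first by rewrite eq_sym.
  move=> ik; have {}ik : i <= k.+1 by []; rewrite ik.
  case: (ltngtP i k.+1) => [ik'|ik'|->].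
  + by rewrite hc.
  + by slia.
  + by rewrite hcg.
case=> [//|i] _ /= ik; have {}ik : i <= k.+2 by []; rewrite ik; apply: leq_trans (leq_maxr 3 _) _.
case: i ik => [_|i ik]; first by rewrite Sf0 cS1.
case: (ltngtP i k.+1) => [ik'|ik'|->].
- apply: leq_trans (hd i ik'); rewrite -[_ :: _](mkseq_cons (fun i => D i.+2)).
  by rewrite nth_mkseq.
- by slia.
- by rewrite SfT cT1.
Qed.
End Extension.

(** * Strong colourings and threads *)

Section Matching.
Variables (V K : finType) (x0 : K).
Implicit Types (A : {set V}) (B : {set K}).

Definition match_sets A B (v : V) : K := nth x0 (enum B) (index v (enum A)).

Lemma match_sets_in A B v : #|A| <= #|B| -> v \in A -> match_sets A B v \in B.
Proof.
move=> AB vA; rewrite -mem_enum /match_sets mem_nth // -cardE.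
by apply: leq_trans AB; rewrite cardE index_mem mem_enum.
Qed.

Lemma match_sets_inj A B : #|A| <= #|B| -> {in A &, injective (match_sets A B)}.
Proof.
move=> AB u v uA vA /eqP; rewrite nth_uniq ?enum_uniq // -?cardE.
- by move/eqP => e; have := nth_index u (s := enum A) (x := u); rewrite e mem_enum uA => <- //; rewrite nth_index ?mem_enum.
- by apply: leq_trans AB; rewrite cardE index_mem mem_enum.
- by apply: leq_trans AB; rewrite cardE index_mem mem_enum.
Qed.
End Matching.

Section Coloring.
Variables V : finType.
Implicit Types (a b : rel V).

Definition degree a x := #|[set y | a x y]|.

(** The middle edge [x u] may itself be one of the two edges compared, so edges sharing an end are
    covered as well. *)
Definition strong_pair_coloring K a (c : V -> V -> K) : Prop :=
  (forall x y, c x y = c y x) /\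
  forall x u y v, a x u -> a x y -> a u v -> c x y = c u v -> y = u /\ v = x.

Lemma strong_pair_inj K a (c : V -> V -> K) x y z : symmetric a ->
  strong_pair_coloring a c -> a x y -> a x z -> c x y = c x z -> y = z.
Proof.
move=> sa [sc hc] xy xz e.
have yx : a y x by rewrite sa.
by have [_ ->] := hc y x x z yx yx xz (etrans (sc y x) e).
Qed.

Lemma strong_pair_sets (K : finType) a (c : V -> V -> K) (S : V -> {set K}) :
  symmetric a -> (forall x y, c x y = c y x) -> (forall x y, a x y -> c x y \in S x) ->
  (forall x y z, a x y -> a x z -> c x y = c x z -> y = z) ->
  (forall x u, a x u -> S x :&: S u \subset [set c x u]) -> strong_pair_coloring a c.
Proof.
move=> sa sc cS ci cI; split=> // x u y v xu xy uv e.
have : c x y \in S x :&: S u by rewrite inE cS // e cS.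
move/(subsetP (cI _ _ xu)); rewrite inE => /eqP e'.
split; first exact: ci e'.
by apply: (ci u) => //; [rewrite sa|rewrite -e e' sc].
Qed.

Lemma degree_sub a b x : subrel a b -> degree a x <= degree b x.
Proof. by move=> ab; apply: subset_leq_card; apply/subsetP => y; rewrite !inE; apply: ab. Qed.

Lemma degree1_uniq a x y z : degree a x = 1 -> a x y -> a x z -> y = z.
Proof.
move/eqP/cards1P => [w e] xy xz.
have : y \in [set y | a x y] by rewrite inE.
have : z \in [set y | a x y] by rewrite inE.
by rewrite e !inE => /eqP -> /eqP ->.
Qed.

(** All subgraphs [b] are included because the colouring argument deletes edges. The degrees of the
    ends [w 0] and [w n.+1] are not prescribed. *)
Definition has_threads n a : Prop := forall b, symmetric b -> subrel b a ->
  (exists x y, b x y) -> (forall x y, b x y -> 1 < degree b x) ->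
  exists w : nat -> V, [/\ forall i, i < n.+1 -> b (w i) (w i.+1),
    forall i j, i <= n.+1 -> j <= n.+1 -> w i = w j -> i = j
    & forall i, 0 < i -> i <= n -> degree b (w i) = 2].

Section Reduction.
Variables (k : nat) (a : rel V).
Hypotheses (k5 : 4 < k) (sa : symmetric a) (ia : irreflexive a).
Hypothesis (deg2 : forall x, degree a x + 2 <= k).
Hypothesis (degs : forall x y, a x y -> degree a x + degree a y <= k.+1).
Let K : finType := 'I_k.
Let k0 : K := Ordinal (leq_trans (isT : 0 < 5) k5).

(** * Pendant edges at a vertex with at most one other neighbour *)

Section LeafStar.
Variables (y0 z0 : V).
Hypothesis (yz : a y0 z0) (lz : degree a z0 = 1).
Hypothesis one : #|[set z | [&& a y0 z, degree a y0 != 1 & degree a z != 1]]| <= 1.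

Definition pendant v := a y0 v && (degree a v == 1).
Definition no_pendant : rel V :=
  fun u v => [&& a u v, ~~ ((u == y0) && pendant v) & ~~ ((v == y0) && pendant u)].

(** A pendant edge at [y0] conflicts only with edges at [y0] and at the one neighbour [p] that is
    not a leaf, if it exists. The degrees of [y0] and [p] add up to at most [k + 1], which leaves
    enough colours. *)
Lemma leaf_star_extend (c' : V -> V -> K) :
  strong_pair_coloring no_pendant c' -> exists c : V -> V -> K, strong_pair_coloring a c.
Proof.
move=> [sc' hc'].
pose P := [set z | a y0 z && (degree a z != 1)].
pose L := [set z | pendant z].
have cPL : #|P| + #|L| = degree a y0.
  rewrite addnC /degree -[RHS](cardsID L); congr (_ + _).
    by apply: eq_card => z; rewrite !inE /pendant; case: (a y0 z); rewrite ?andbT.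
  by apply: eq_card => z; rewrite !inE /pendant; case: (a y0 z) => //=; rewrite andbT.
have cP : #|P| <= 1.
  case: (eqVneq (degree a y0) 1) => [e|ne].
    rewrite (_ : P = set0) ?cards0 //; apply/setP => z; rewrite !inE.
    by apply/negP => /andP[yz' /negP]; apply; rewrite -(degree1_uniq e yz yz') lz.
  by apply: leq_trans one; apply: subset_leq_card; apply/subsetP => z; rewrite !inE ne.
have sa' : symmetric no_pendant.
  by move=> u v; rewrite /no_pendant sa [X in _ && X]andbC.
(* [F] consists of the colours at [p], that of the edge between [y0] and [p] included; it is empty
   if there is no [p]. *)
have [F cF hF] : exists2 F : {set K}, #|L| + #|F| <= k &
    forall p v, p \in P -> no_pendant p v -> c' p v \in F.
  case: (set_0Vmem P) => [P0|[p pP]].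
    exists set0; last by move=> p v; rewrite P0 inE.
    by rewrite cards0 addn0; have := deg2 y0; rewrite -cPL P0 cards0; lia.
  exists [set c' p v | v in [set v | no_pendant p v]]; last first.
    move=> q v qP qv; have /card_le1_eqP/(_ p q pP qP) qp := cP.
    by rewrite qp; apply: imset_f; rewrite inE -qp.
  have : #|[set c' p v | v in [set v | no_pendant p v]]| <= degree a p.
    apply: leq_trans (leq_imset_card _ _) _; apply: subset_leq_card.
    by apply/subsetP => v; rewrite !inE => /and3P[].
  have ap : a y0 p by move: pP; rewrite inE => /andP[].
  by have := degs ap; rewrite -cPL (cardsD1 p) pP; lia.
pose h := match_sets k0 L (~: F).
have cLF : #|L| <= #|~: F|.
  by have := cardsC F; rewrite card_ord; lia.
have hF' v : v \in L -> h v \notin F by move/(match_sets_in k0 cLF); rewrite inE.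
have hi : {in L &, injective h} := @match_sets_inj _ _ k0 _ _ cLF.
have inL z : (z \in L) = pendant z by rewrite inE.
have y0L : pendant y0 = false by rewrite /pendant ia.
pose c u v := if (u == y0) && pendant v then h v
  else if (v == y0) && pendant u then h u else c' u v.
have sc u v : c u v = c v u.
  rewrite /c; case: (eqVneq u y0) => [->|] /=; case: (eqVneq v y0) => [->|] /=;
  by do ?case: ifP => // _; rewrite sc'.
have leafnb u v : pendant u -> a u v -> v = y0.
  by case/andP=> y0u /eqP l uv; apply: (degree1_uniq l) => //; rewrite sa.
have leafcase x u y v : pendant x -> a x u -> a x y -> a u v -> c x y = c u v -> y = u /\ v = x.
  move=> px xu xy uv; rewrite (leafnb _ _ px xu) (leafnb _ _ px xy) in uv *.
  rewrite sc /c eqxx px /=; case: ifP => [pv e|npv].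
    by split=> //; apply: hi; rewrite ?inL // e.
  rewrite y0L andbF => e.
  have vP : v \in P by move: npv; rewrite inE uv /pendant uv /= => ->.
  have : h x \in F.
    rewrite e sc'; apply: hF => //; rewrite /no_pendant sa uv eqxx npv andbT /=.
    by rewrite y0L andbF.
  by rewrite (negbTE (hF' _ _)) // inL.
have centre u y v : ~~ pendant u -> a y0 u -> a y0 y -> a u v -> c y0 y = c u v -> y = u /\ v = y0.
  move=> npu y0u y0y uv.
  have uy : u != y0 by apply: contraTneq y0u => ->; rewrite ia.
  have uv' : no_pendant u v by rewrite /no_pendant uv (negbTE npu) (negbTE uy) andbF.
  have uP : u \in P by move: npu; rewrite inE y0u /pendant y0u.
  rewrite /c eqxx y0L (negbTE uy) (negbTE npu) !andbF /=; case: ifP => [py e|npy e].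
    by have := hF u v uP uv'; rewrite -e (negbTE (hF' _ _)) // inL.
  by apply: hc' e => //; rewrite /no_pendant ?y0u ?y0y ?npy ?(negbTE npu) ?y0L ?andbF.
exists c; split=> // x u y v xu xy uv e.
case: (boolP (pendant x)) => [px|npx]; first exact: (leafcase x u).
case: (boolP (pendant u)) => [pu|npu].
  by have [] := leafcase u x v y pu; rewrite // sa.
case: (eqVneq x y0) => [xy0|nxy]; first by subst x; apply: centre.
case: (eqVneq u y0) => [uy0|nuy].
  by subst u; have [] := centre x v y npx; rewrite // sa.
move: e; rewrite /c (negbTE nxy) (negbTE nuy) (negbTE npx) (negbTE npu) !andbF /= => e.
apply: hc' e; rewrite /no_pendant ?xu ?xy ?uv ?(negbTE nxy) ?(negbTE nuy) ?(negbTE npx) ?(negbTE npu) ?andbF //.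
Qed.
End LeafStar.

(** * Recolouring a thread *)

Section Thread.
Variable w : nat -> V.
Let leaf v := degree a v == 1.
Let core : rel V := fun u v => [&& a u v, ~~ leaf u & ~~ leaf v].
Hypothesis w_adj : forall i, i < k.+4 -> core (w i) (w i.+1).
Hypothesis w_inj : forall i j, i <= k.+4 -> j <= k.+4 -> w i = w j -> i = j.
Hypothesis w_deg : forall i, 0 < i -> i <= k.+3 -> degree core (w i) = 2.

(** A vertex off the thread gets position [k + 5], which is out of range. *)
Definition thread_pos x := index x (mkseq w k.+4.+1).
Definition on_thread x := 0 < thread_pos x < k.+4.
Notation pos := thread_pos.
Notation inner := on_thread.

(** The first and the last edge of the thread stay, so that the colouring of the rest fixes their
    colours and the colour sets at [w 0] and [w k.+4]. *)
Definition cut_thread : rel V := fun u v => a u v &&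
  [|| ~~ on_thread u && ~~ on_thread v, (u == w 0) && (v == w 1), (v == w 0) && (u == w 1),
      (u == w k.+3) && (v == w k.+4) | (v == w k.+3) && (u == w k.+4)].

Let posw i : i <= k.+4 -> pos (w i) = i.
Proof.
move=> ik; rewrite /thread_pos -(nth_mkseq (w 0) w (i := i) (n := k.+4.+1)) // index_uniq ?size_mkseq //.
rewrite map_inj_in_uniq ?iota_uniq // => u v; rewrite !mem_iota !add0n !ltnS.
exact: w_inj.
Qed.

Let wpos x : pos x <= k.+4 -> w (pos x) = x.
Proof.
move=> xk; have := xk; rewrite /thread_pos -ltnS -[X in _ < X](size_mkseq w) index_mem => xs.
by rewrite -{2}(nth_index (w 0) xs) nth_mkseq.
Qed.

Let w_leaf i : i <= k.+4 -> leaf (w i) = false.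
Proof.
move=> ik; case: (ltngtP i k.+4) ik => // [ik _|->_]; apply/negbTE.
  by have /and3P[] := w_adj ik.
by have /and3P[] := w_adj (ltnSn k.+3).
Qed.

Local Opaque thread_pos.

Lemma on_thread_w i : i <= k.+4 -> inner (w i) = (0 < i < k.+4).
Proof. by move=> ik; rewrite /on_thread posw. Qed.

Let inner_nbr i v : 0 < i -> i < k.+4 -> a (w i) v -> [|| leaf v, v == w i.-1 | v == w i.+1].
Proof.
case: i => // i _ ik iv; case: (boolP (leaf v)) => //= lv.
have ne : w i != w i.+2.
  by apply/eqP => /w_inj e; have := e (ltnW (ltnW ik)) ik; lia.
have sub : [set w i; w i.+2] \subset [set y | core (w i.+1) y].
  rewrite subUset !sub1set !inE w_adj // andbT.
  by have := w_adj (ltnW ik); rewrite /core sa andbCA andbC !andbA andbC andbA andbC.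
have /eqP e : [set w i; w i.+2] == [set y | core (w i.+1) y].
  by rewrite eqEcard sub cards2 ne; have := w_deg (isT : 0 < i.+1); rewrite /degree => ->.
have : v \in [set y | core (w i.+1) y] by rewrite inE /core iv lv w_leaf // ltnW.
by rewrite -e !inE.
Qed.

Let innerP x : inner x -> exists2 i, 0 < i < k.+4 & x = w i.
Proof.
rewrite /on_thread => h; exists (pos x) => //.
by rewrite wpos //; case/andP: h => _ /ltnW.
Qed.

Let inner_leaf x : inner x -> leaf x = false.
Proof. by case/innerP => i /andP[_ /ltnW ik] ->; rewrite w_leaf. Qed.

Lemma cut_thread_sym : symmetric cut_thread.
Proof.
move=> u v; rewrite /cut_thread sa; congr (_ && _).
by rewrite andbC ![(v == _) && _]andbC; do ![case: (_ && _) => //=].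
Qed.

(** [path_extension] provides the sets along the thread. The pendant edges at an interior vertex
    receive the colours of its set that the two thread edges leave free. *)
Lemma thread_extend (c' : V -> V -> K) :
  strong_pair_coloring cut_thread c' -> exists c : V -> V -> K, strong_pair_coloring a c.
Proof.
move=> hc'; have [sc' c'P] := hc'.
have star x : #|[set c' x v | v in [set v | cut_thread x v]]| <= degree a x.
  apply: leq_trans (leq_imset_card _ _) _; apply: subset_leq_card.
  by apply/subsetP => v; rewrite !inE => /andP[].
have w_a i : i < k.+4 -> a (w i) (w i.+1) by move/w_adj/and3P => [].
have cut01 : cut_thread (w 0) (w 1) by rewrite /cut_thread w_a //= !eqxx orbT.
have cutN : cut_thread (w k.+4) (w k.+3).
  by rewrite cut_thread_sym /cut_thread w_a //= !eqxx !orbT.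
have [||||||||||S [cc [[S0 SN] [cc0 ccN] SI ccne Scard]]] := @path_extension K k
  [set c' (w 0) v | v in [set v | cut_thread (w 0) v]]
  [set c' (w k.+4) v | v in [set v | cut_thread (w k.+4) v]]
  (c' (w 0) (w 1)) (c' (w k.+4) (w k.+3)) (fun i => degree a (w i)).
- by rewrite card_ord.
- exact: k5.
- by apply: imset_f; rewrite inE.
- by apply: imset_f; rewrite inE.
- by have := star (w 0); have := deg2 (w 0); lia.
- by have := star (w k.+4); have := deg2 (w k.+4); lia.
- by have := star (w 0); have := degs (w_a 0 isT); lia.
- by have := star (w k.+4); have := degs (w_a k.+3 (ltnSn _)); lia.
- by move=> i _ _; apply: deg2.
- by move=> i _ ik; apply: degs; apply: w_a; lia.
have ccS i : i < k.+4 -> (cc i \in S i) && (cc i \in S i.+1).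
  by move=> ik; rewrite -in_setI SI // inE.
pose L i := [set v | a (w i) v && leaf v].
pose A i := S i :\ cc i.-1 :\ cc i.
have cLA i : 0 < i < k.+4 -> #|L i| <= #|A i|.
  case: i => // i /= ik.
  have c1 : cc i \in S i.+1 by case/andP: (ccS i (ltnW ik)).
  have c2 : cc i.+1 \in S i.+1 by case/andP: (ccS i.+1 ik).
  have ne : cc i.+1 != cc i by rewrite eq_sym ccne.
  have := Scard i.+1 isT ik.
  rewrite (cardsD1 (cc i) (S _)) c1 (cardsD1 (cc i.+1) (S _ :\ _)) !inE ne c2 -/(A i.+1).
  suff -> : degree a (w i.+1) = #|L i.+1| + 2 by rewrite addnC.
  rewrite -(w_deg (isT : 0 < i.+1) ik) /degree -[LHS](cardsID [set v | leaf v]).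
  congr (_ + _); apply: eq_card => v; rewrite !inE // /core w_leaf 1?ltnW //.
  by rewrite /= andbC.
pose h i := match_sets k0 (L i) (A i).
have hA i v : 0 < i < k.+4 -> v \in L i -> h i v \in A i.
  by move=> ik; apply: match_sets_in; apply: cLA.
have hinj i : 0 < i < k.+4 -> {in L i &, injective (h i)}.
  by move=> ik; apply: match_sets_inj; apply: cLA.
pose cn u v := if inner u && leaf v then h (pos u) v
  else if inner v && leaf u then h (pos v) u
  else if (pos u <= k.+3) && (pos v == (pos u).+1) then cc (pos u)
  else if (pos v <= k.+3) && (pos u == (pos v).+1) then cc (pos v) else c' u v.
have link u v :
    (if (pos u <= k.+3) && (pos v == (pos u).+1) then cc (pos u)
     else if (pos v <= k.+3) && (pos u == (pos v).+1) then cc (pos v) else c' u v) =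
    (if (pos v <= k.+3) && (pos u == (pos v).+1) then cc (pos v)
     else if (pos u <= k.+3) && (pos v == (pos u).+1) then cc (pos u) else c' v u).
  rewrite (sc' u v); case: ifP => [/andP[_ /eqP ->]|//]; case: ifP => // /andP[_ /eqP e].
  by exfalso; move: e; clear; lia.
have scn u v : cn u v = cn v u.
  rewrite /cn; case: (boolP (inner u)) => iu; case: (boolP (inner v)) => iv /=;
    rewrite ?(inner_leaf iu) ?(inner_leaf iv) //=.
  - by case: (leaf v) => //; exact: link.
  - by case: (leaf u) => //; exact: link.
have cnw i : i < k.+4 -> cn (w i) (w i.+1) = cc i.
  move=> ik; have ik' := ltnW ik; have ik2 : i <= k.+3 by [].
  by rewrite /cn !w_leaf // !andbF /= !posw // eqxx ik2.
have cnl i v : 0 < i < k.+4 -> leaf v -> cn (w i) v = h i v.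
  move=> ik lv; have ik' : i <= k.+4 by case/andP: ik => _ /ltnW.
  by rewrite /cn on_thread_w // ik lv /= posw.
(* At a vertex that is neither interior nor a leaf hanging on the interior, [cn] agrees with [c'];
   for the two end edges this is the choice of [cc]. *)
have good x u y : ~~ inner x -> a x u -> ~~ leaf x || ~~ inner u -> a x y ->
    cut_thread x y /\ cn x y = c' x y.
  move=> nx xu lu xy; case: (boolP (inner y)) => iy; last first.
    rewrite /cut_thread xy /= nx iy; split=> //.
    rewrite /cn (negbTE nx) (negbTE iy) /=.
    case: ifP => [/andP[px /eqP py]|_].
      have xE : w (pos x) = x by apply: wpos; lia.
      have yE : w (pos y) = y by apply: wpos; lia.
      by move: nx iy; rewrite -xE -yE !on_thread_w; lia.
    case: ifP => [/andP[px /eqP py]|//].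
    have xE : w (pos x) = x by apply: wpos; lia.
    have yE : w (pos y) = y by apply: wpos; lia.
    by move: nx iy; rewrite -xE -yE !on_thread_w; lia.
  have lx : ~~ leaf x.
    apply: contraTN iy => lx; move: lu; rewrite lx /=.
    by rewrite (degree1_uniq (eqP lx) xu xy).
  have [j /andP[j0 jk] yj] := innerP iy; subst y.
  have := inner_nbr j0 jk; move/(_ x); rewrite sa xy => /(_ isT).
  rewrite (negbTE lx) /=; case/orP => /eqP xE; subst x.
    move: nx; rewrite on_thread_w; last by lia.
    move=> nx; have j1 : j = 1 by lia.
    by subst j; split=> //; rewrite cnw.
  move: nx; rewrite on_thread_w; last by lia.
  move=> nx; have jN : j = k.+3 by lia.
  by subst j; split=> //; rewrite scn cnw.
(* Prescribed sets on the thread, actual colour sets elsewhere. *)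
pose Sx x := if pos x <= k.+4 then S (pos x) else [set cn x v | v in [set v | a x v]].
have Sout x u : ~~ inner x -> a x u -> ~~ leaf x || ~~ inner u ->
    Sx x \subset [set c' x v | v in [set v | cut_thread x v]].
  move=> nx xu lu; rewrite /Sx; case: ifP => px.
    have xE := wpos px; move: (nx); rewrite -xE on_thread_w // posw // => nx'.
    have [->|->] : pos x = 0 \/ pos x = k.+4 by lia.
      by rewrite S0.
    by rewrite SN.
  apply/subsetP => t /imsetP[v]; rewrite inE => xv ->.
  by have [xv' ->] := good x u v nx xu lu xv; apply: imset_f; rewrite inE.
have Sinner x : inner x -> Sx x = S (pos x).
  by case/innerP => i /andP[_ /ltnW ik] ->; rewrite /Sx posw // ik.
exists cn; apply: (strong_pair_sets (S := Sx)) => //.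
- move=> x y xy; rewrite /Sx; case: ifP => px; last by apply: imset_f; rewrite inE.
  have xE := wpos px; case: (boolP (inner x)) => ix.
    have [i /andP[i0 ik] xi] := innerP ix; subst x; rewrite (posw (ltnW ik)).
    have /or3P[ly|/eqP ->|/eqP ->] := inner_nbr i0 ik xy.
    + rewrite cnl ?i0 //.
      by have := @hA i y; rewrite i0 ik /L inE xy ly /A !inE => /(_ isT isT)/and3P[].
    + case: i i0 ik {ix px xE xy} => // i _ ik; rewrite scn cnw /=; last exact: ltnW.
      by case/andP: (ccS i (ltnW ik)).
    + by rewrite cnw //; case/andP: (ccS i ik).
  have lx : ~~ leaf x by rewrite -xE w_leaf.
  have [xy' ->] := good x y y ix xy (introT orP (or_introl lx)) xy.
  move: (ix); rewrite -xE on_thread_w // posw // => nx'.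
  have [e|e] : pos x = 0 \/ pos x = k.+4 by lia.
    have xw : x = w 0 by rewrite -e xE.
    by rewrite e S0; apply: imset_f; rewrite inE -xw.
  have xw : x = w k.+4 by rewrite -e xE.
  by rewrite e SN; apply: imset_f; rewrite inE -xw.
- move=> x y z xy xz; case: (boolP (inner x)) => ix; last first.
    case: (boolP (leaf x)) => lx; first by move=> _; apply: degree1_uniq xy xz; apply/eqP.
    have lx' : ~~ leaf x || ~~ inner y by rewrite lx.
    have [xy' ->] := good x y y ix xy lx' xy.
    have [xz' ->] := good x y z ix xy lx' xz.
    exact: (strong_pair_inj cut_thread_sym hc').
  have [i /andP[i0 ik] xi] := innerP ix; subst x.
  have i0k : 0 < i < k.+4 by rewrite i0.
  have hcc v : leaf v -> a (w i) v -> h i v != cc i.-1 /\ h i v != cc i.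
    move=> lv iv; have := hA i v i0k; rewrite /L inE iv lv /A !inE => /(_ isT).
    by case/and3P.
  have ncc : cc i.-1 != cc i by case: i i0 ik {ix xy xz i0k hcc} => //= i _; apply: ccne.
  have pE : cn (w i) (w i.-1) = cc i.-1.
    by rewrite scn -{2}(prednK i0) cnw //; lia.
  have /or3P[ly|/eqP ->|/eqP ->] := inner_nbr i0 ik xy;
  have /or3P[lz|/eqP ->|/eqP ->] := inner_nbr i0 ik xz;
    rewrite ?pE ?(cnw i ik) ?(cnl i) // => /eqP e.
  + by apply: (hinj i) => //; [rewrite inE xy ly|rewrite inE xz lz|apply/eqP].
  + by have [h1 h2] := hcc _ ly xy; rewrite e in h1.
  + by have [h1 h2] := hcc _ ly xy; rewrite e in h2.
  + by have [h1 h2] := hcc _ lz xz; rewrite eq_sym e in h1.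
  + by rewrite e in ncc.
  + by have [h1 h2] := hcc _ lz xz; rewrite eq_sym e in h2.
  + by rewrite eq_sym e in ncc.
move=> x u xu.
have half x1 u1 : a x1 u1 -> inner x1 -> ~~ inner u1 -> Sx x1 :&: Sx u1 \subset [set cn x1 u1].
  move=> xu1 ix iu; have [i /andP[i0 ik] xi] := innerP ix; subst x1.
  have /or3P[lu|/eqP ue|/eqP ue] := inner_nbr i0 ik xu1.
  - apply/subsetP => t; rewrite in_setI => /andP[_]; rewrite /Sx; case: ifP => [pu|_].
      by have := wpos pu => ue; rewrite -ue w_leaf in lu.
    case/imsetP => v; rewrite !inE => uv ->.
    have ux1 : a u1 (w i) by rewrite sa.
    by rewrite (degree1_uniq (eqP lu) uv ux1) (scn u1).
  - subst u1; case: i i0 ik ix iu xu1 => //= i _ ik ix iu _.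
    have ik1 := ltnW ik; have ik2 := ltnW ik1.
    by rewrite scn (cnw i ik1) /Sx !posw // ik1 ik2 setIC SI.
  - by subst u1; have ik1 := ltnW ik; rewrite (cnw i ik) /Sx !posw // ik ik1 SI.
case: (boolP (inner x)) => ix; case: (boolP (inner u)) => iu.
- have [i /andP[i0 ik] xi] := innerP ix; subst x.
  have /or3P[lu|/eqP ue|/eqP ue] := inner_nbr i0 ik xu.
  + by rewrite (inner_leaf iu) in lu.
  + subst u; case: i i0 ik ix iu xu => //= i _ ik ix iu _.
    have ik1 := ltnW ik; have ik2 := ltnW ik1.
    by rewrite scn (cnw i ik1) /Sx !posw // ik1 ik2 setIC SI.
  + by subst u; have ik1 := ltnW ik; rewrite (cnw i ik) /Sx !posw // ik ik1 SI.
- exact: half.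
- by rewrite setIC scn; apply: half => //; rewrite sa.
(* Neither end is interior, so all colours concerned come from the strong colouring [c']. *)
have ux : a u x by rewrite sa.
have lx : ~~ leaf x || ~~ inner u by rewrite iu orbT.
have lu : ~~ leaf u || ~~ inner x by rewrite ix orbT.
apply/subsetP => t; rewrite in_setI => /andP[tx tu].
have /imsetP[y] := subsetP (Sout x u ix xu lx) t tx.
have /imsetP[v] := subsetP (Sout u x iu ux lu) t tu.
rewrite !inE => uv -> xy e.
have [xu' ->] := good x u u ix xu lx xu.
have [yu vx] := c'P x u y v xu' xy uv (esym e).
by rewrite e yu.
Qed.
End Thread.
End Reduction.

(** If no leaf hangs at a vertex with at most one neighbour in [core], then [core] has an edge and
    its non-isolated vertices have degree at least 2 there, since a vertex without leaf neighbours
    keeps its degree. Hence [core] contains a thread. *)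
Theorem strong_coloring_of_threads k a : 4 < k -> symmetric a -> irreflexive a ->
  (forall x, degree a x + 2 <= k) -> (forall x y, a x y -> degree a x + degree a y <= k.+1) ->
  has_threads k.+3 a -> exists c : V -> V -> 'I_k, strong_pair_coloring a c.
Proof.
move=> k5; have [n] := ubnP #|[set p : V * V | a p.1 p.2]|.
elim: n a => // n IH a; rewrite ltnS => an sa ia deg2 degs th.
have sub_IH b : symmetric b -> subrel b a -> (exists x y, a x y && ~~ b x y) ->
    exists c : V -> V -> 'I_k, strong_pair_coloring b c.
  move=> sb ba [x [y /andP[xy nxy]]]; apply: IH => //.
  - apply: leq_trans an; apply: proper_card; apply/properP; split.
      by apply/subsetP => p; rewrite !inE; apply: ba.
    by exists (x, y); rewrite !inE.
  - by move=> z; apply: contraFF (ia z); apply: ba.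
  - by move=> z; have := degree_sub z ba; have := deg2 z; clear; lia.
  - move=> z t zt; have := degree_sub z ba; have := degree_sub t ba.
    by have := degs z t (ba _ _ zt); clear; lia.
  by move=> d sd db; apply: th => // u v /db/ba.
pose leaf v := degree a v == 1.
case: (boolP [exists x, exists y, a x y]) => [/existsP[x1 /existsP[y1 xy1]]|na]; last first.
  exists (fun _ _ => Ordinal (leq_trans (isT : 0 < 5) k5)); split=> // x u y v xu.
  by case/negP: na; apply/existsP; exists x; apply/existsP; exists u.
pose core : rel V := fun u v => [&& a u v, ~~ leaf u & ~~ leaf v].
case: (boolP [exists y, exists z, [&& a y z, leaf z & degree core y <= 1]]) => [|nred].
  case/existsP => y /existsP[z /and3P[yz /eqP lz cy]].
  have [|||c' hc'] := sub_IH (no_pendant a y).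
  - by move=> u v; rewrite /no_pendant sa [X in _ && X]andbC.
  - by move=> u v /and3P[].
  - by exists y, z; rewrite yz /no_pendant /pendant yz lz !eqxx.
  apply: (leaf_star_extend k5 sa ia deg2 degs yz lz _ hc').
  apply: leq_trans cy; apply: subset_leq_card; apply/subsetP => v; rewrite !inE.
  by case/and3P => yv ly lv; rewrite /core yv /leaf ly lv.
have core_deg y z : a y z -> leaf z -> 1 < degree core y.
  move=> yz lz; rewrite ltnNge; apply: contra nred => cy.
  by apply/existsP; exists y; apply/existsP; exists z; rewrite yz lz.
have [||||w [w_adj w_inj w_deg]] := th core.
- by move=> u v; rewrite /core sa [X in _ && X]andbC.
- by move=> u v /and3P[].
- case: (boolP (leaf y1)) => ly; last case: (boolP (leaf x1)) => lx.
  + have [v] := card_gt0_pick (ltnW (core_deg _ _ xy1 ly)).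
    by rewrite inE => x1v; exists x1, v.
  + have [v] := card_gt0_pick (ltnW (core_deg y1 x1 (etrans (sa _ _) xy1) lx)).
    by rewrite inE => x1v; exists y1, v.
  + by exists x1, y1; rewrite /core xy1 lx ly.
- move=> x y /and3P[xy lx ly].
  case: (boolP [exists z, a x z && leaf z]) => [/existsP[z /andP[xz lz]]|nl].
    exact: core_deg xz lz.
  have -> : degree core x = degree a x.
    apply: eq_card => v; rewrite !inE /core lx /=; case: (boolP (a x v)) => //= xv.
    by apply: contra nl => lv; apply/existsP; exists v; rewrite xv lv.
  rewrite ltn_neqAle eq_sym lx /= /degree card_gt0.
  by apply/set0Pn; exists y; rewrite inE.
have [|||c' hc'] := sub_IH (cut_thread k a w).
- exact: cut_thread_sym.
- by move=> u v /andP[].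
- exists (w 1), (w 2); have /and3P[w12 _ _] := w_adj 1 isT.
  rewrite w12 /cut_thread w12 /=.
  have ow1 : on_thread k w (w 1) by rewrite (on_thread_w w_inj).
  have ow2 : on_thread k w (w 2) by rewrite (on_thread_w w_inj).
  have ne i j : i <= k.+4 -> j <= k.+4 -> i != j -> (w i == w j) = false.
    by move=> ik jk ij; apply/negP => /eqP /(w_inj _ _ ik jk) /eqP; apply/negP.
  by rewrite ow1 ow2 /= (ne 1 0) // (ne 2 0) // (ne 1 k.+3) // (ne 1 k.+4) //= andbF.
exact: (thread_extend k5 sa deg2 degs w_adj w_inj w_deg hc').
Qed.
End Coloring.

(** * Drawings in the grid and MacLane's inequality *)

Import Order.TTheory GRing.Theory Num.Theory.

Section Grid.
Local Open Scope ring_scope.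
Notation pt := (int * int)%type.
Implicit Types (z p : pt) (m : pt * pt).

Definition nbrs z : seq pt :=
  [:: (z.1 + 1, z.2); (z.1 - 1, z.2); (z.1, z.2 + 1); (z.1, z.2 - 1)].

Arguments nbrs : simpl never.

Definition lo (x y : int) : int := if x <= y then x else y.

(* The unit square with lower left corner [p] is denoted by [p]. These are the
   two squares on the sides of the unit segment between neighbours [z] and [z']. *)
Definition side1 z z' : pt :=
  if z.1 == z'.1 then (z.1 - 1, lo z.2 z'.2) else (lo z.1 z'.1, z.2 - 1).
Definition side2 z z' : pt :=
  if z.1 == z'.1 then (z.1, lo z.2 z'.2) else (lo z.1 z'.1, z.2).

Definition axis m := (m.1.1 == m.2.1) || (m.1.2 == m.2.2).

(* Does the axis-parallel segment [m] cross the horizontal ray going right from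
   the centre of the square [p]? Does it cover the unit segment from [z] to [z']? *)
Definition crosses m p := (p.1 < m.1.1) && ((m.1.2 <= p.2) (+) (m.2.2 <= p.2)).
Definition covers m z z' :=
  if z.1 == z'.1 then
    (m.1.1 == z.1) && ((m.1.2 <= lo z.2 z'.2) (+) (m.2.2 <= lo z.2 z'.2))
  else (m.1.2 == z.2) && ((m.1.1 <= lo z.1 z'.1) (+) (m.2.1 <= lo z.1 z'.1)).
(** The two squares beside a horizontal unit segment have rays in neighbouring rows; this term
    records an end [w] lying between these rays. *)
Definition end_term z z' w :=
  (z.1 != z'.1) && (w.2 == z.2) && (lo z.1 z'.1 < w.1).

Lemma nbrsP z z' : z' \in nbrs z ->
  [\/ z' = (z.1 + 1, z.2), z' = (z.1 - 1, z.2), z' = (z.1, z.2 + 1) | z' = (z.1, z.2 - 1)].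
Proof. by rewrite !inE => /or4P[]/eqP; [constructor 1|constructor 2|constructor 3|constructor 4]. Qed.

Lemma mem_nbrs_sym z z' : (z' \in nbrs z) = (z \in nbrs z').
Proof.
case: z z' => [x y] [x' y']. rewrite !inE /=. rewrite -!pair_eqE /pair_eq /=; lia.
Qed.

(** Passing a unit segment changes the crossing parity exactly when [m] covers it, up to terms at
    the ends of [m]. Those telescope along a chain and cancel over an even set of edges. *)
Lemma crosses_side m z z' : axis m -> z' \in nbrs z ->
  crosses m (side1 z z') (+) crosses m (side2 z z') =
  covers m z z' (+) (end_term z z' m.1 (+) end_term z z' m.2).
Proof.
case: m z => -[a b] [c d] [x y]; rewrite /axis /= => h.
by case/nbrsP => ->; rewrite /crosses /side1 /side2 /covers /end_term /lo /=;
  do ![case: ifP => /= ?]; lia.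
Qed.

Lemma side_sym z z' : z' \in nbrs z -> side1 z z' = side1 z' z /\ side2 z z' = side2 z' z.
Proof.
by case: z => [x y]; case/nbrsP => ->; rewrite /side1 /side2 /lo /=; split;
  do ![case: ifP => ? //]; try (congr pair); lia.
Qed.

Definition in_seg m z :=
  [|| (m.1.1 == m.2.1) && (z.1 == m.1.1) && (((m.1.2 <= z.2) && (z.2 <= m.2.2)) || ((m.2.2 <= z.2) && (z.2 <= m.1.2)))
   | (m.1.2 == m.2.2) && (z.2 == m.1.2) && (((m.1.1 <= z.1) && (z.1 <= m.2.1)) || ((m.2.1 <= z.1) && (z.1 <= m.1.1)))].

Lemma covers_in_seg m z z' : axis m -> z' \in nbrs z -> covers m z z' ->
  in_seg m z && in_seg m z'.
Proof.
case: m z => -[a b] [c d] [x y]; rewrite /axis /= => h.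
by case/nbrsP => ->; rewrite /covers /in_seg /lo /=; do ![case: ifP => /= ?]; lia.
Qed.

Definition step z z' := (z' == z) || (z' \in nbrs z).

Lemma step_axis z z' : step z z' -> axis (z, z').
Proof.
by rewrite /step /axis => /orP[/eqP -> | /nbrsP[] ->]; rewrite /= ?eqxx ?orbT.
Qed.

Lemma covers_step a b z z' : step a b -> z' \in nbrs z -> covers (a, b) z z' ->
  (z = a /\ z' = b) \/ (z = b /\ z' = a).
Proof.
case: a b z z' => [a1 a2] [b1 b2] [z1 z2] [w1 w2].
rewrite /step !inE -!pair_eqE /pair_eq /= /covers /lo /= => h1 h2 h3.
have [h|h] : (z1 == a1) && (z2 == a2) && (w1 == b1) && (w2 == b2) \/
    (z1 == b1) && (z2 == b2) && (w1 == a1) && (w2 == a2) by move: h3; do ![case: ifP => /= ?]; lia.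
  by left; case/andP: h => /andP[/andP[/eqP -> /eqP ->] /eqP ->] /eqP ->.
by right; case/andP: h => /andP[/andP[/eqP -> /eqP ->] /eqP ->] /eqP ->.
Qed.

Lemma covers_self z z' : z' \in nbrs z -> covers (z, z') z z'.
Proof. by case: z => x y; case/nbrsP => ->; rewrite /covers /lo /=; do ![case: ifP => /= ?]; lia. Qed.

Lemma big_addb_odd (I : Type) (s : seq I) (P F : pred I) :
  \big[addb/false]_(i <- s | P i) F i = odd (count (predI P F) s).
Proof.
elim: s => [|i s IH]; first by rewrite big_nil.
rewrite big_cons IH /=; case: (P i) => //=.
by rewrite oddD; case: (F i).
Qed.

Lemma big_addb_card (I : finType) (A : {set I}) (F : pred I) :
  \big[addb/false]_(i in A) F i = odd #|[set i in A | F i]|.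
Proof.
rewrite big_addb_odd -sum1_count -sum1_card; congr odd; apply: eq_bigl => i.
by rewrite !inE.
Qed.

Definition border (S : seq pt) := [seq (z, z') | z <- S, z' <- [seq z' <- nbrs z | z' \notin S]].

(** Summing the condition around each point over [S] counts every unit segment inside [S] twice, so
    only the border remains. *)
Lemma border_sum (S : seq pt) (D : pt -> pt -> bool) : uniq S ->
  (forall z z', z' \in nbrs z -> D z z' = D z' z) ->
  (forall z, \big[addb/false]_(z' <- nbrs z) D z z' = false) ->
  \big[addb/false]_(p <- border S) D p.1 p.2 = false.
Proof.
move=> uS sD hD.
rewrite /border big_allpairs_dep.
under eq_bigr do rewrite big_filter.
have tot : \big[addb/false]_(z <- S) \big[addb/false]_(z' <- nbrs z) D z z' = false.
  by rewrite big1.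
have split_in z : \big[addb/false]_(z' <- nbrs z) D z z' =
    \big[addb/false]_(z' <- nbrs z | z' \notin S) D z z' (+)
    \big[addb/false]_(z' <- nbrs z | z' \in S) D z z'.
  rewrite (bigID (fun z' => z' \notin S)) /=; congr (_ (+) _).
  by apply: eq_bigl => z'; rewrite negbK.
rewrite (eq_bigr _ (fun z _ => split_in z)) big_split /= in tot.
suff inn : \big[addb/false]_(z <- S) \big[addb/false]_(z' <- nbrs z | z' \in S) D z z' = false.
  by rewrite inn addbF in tot.
(* Translation matches the inner segments of two opposite directions, whose sums therefore
   cancel. *)
have dirE (f : pt -> pt) (g : pt -> pt) :
    cancel f g -> cancel g f -> (forall z, f z \in nbrs z) ->
    \big[addb/false]_(z <- S | f z \in S) D z (f z) =
    \big[addb/false]_(z <- S | g z \in S) D z (g z).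
  move=> fg gf hf; rewrite -big_filter -[RHS]big_filter.
  have -> : \big[addb/false]_(z <- [seq z <- S | g z \in S]) D z (g z) =
     \big[addb/false]_(z <- map f [seq z <- S | f z \in S]) D z (g z).
    apply: perm_big; apply: uniq_perm; rewrite ?filter_uniq //.
      by rewrite map_inj_uniq ?filter_uniq //; apply: can_inj fg.
    move=> z; rewrite mem_filter; apply/andP/mapP.
      by move=> [gz zS]; exists (g z); rewrite ?gf // mem_filter gf zS.
    by case=> z'; rewrite mem_filter => /andP[fz z'S] ->; rewrite fg.
  by rewrite big_map; apply: eq_bigr => z _; rewrite fg sD.
have nb4 z : \big[addb/false]_(z' <- nbrs z | z' \in S) D z z' =
   ((if (z.1 + 1, z.2) \in S then D z (z.1 + 1, z.2) else false) (+)
    (if (z.1 - 1, z.2) \in S then D z (z.1 - 1, z.2) else false)) (+)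
   ((if (z.1, z.2 + 1) \in S then D z (z.1, z.2 + 1) else false) (+)
    (if (z.1, z.2 - 1) \in S then D z (z.1, z.2 - 1) else false)).
  by rewrite big_mkcond !big_cons big_nil /= addbF !addbA.
under eq_bigr do rewrite nb4.
rewrite !big_split /= -!big_mkcond /=.
rewrite (dirE (fun z => (z.1 + 1, z.2)) (fun z => (z.1 - 1, z.2))).
- rewrite addbb (dirE (fun z => (z.1, z.2 + 1)) (fun z => (z.1, z.2 - 1))) ?addbb //.
  + by move=> [x y] /=; rewrite addrK.
  + by move=> [x y] /=; rewrite subrK.
  + by move=> z; rewrite !inE eqxx !orbT.
- by move=> [x y] /=; rewrite addrK.
- by move=> [x y] /=; rewrite subrK.
- by move=> z; rewrite !inE eqxx.
Qed.

Lemma uniq_border S : uniq S -> uniq (border S).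
Proof.
move=> uS; apply: allpairs_uniq_dep => //.
- move=> [x y] _; rewrite filter_uniq //= !inE !negb_or -!pair_eqE /pair_eq /=; lia.
- by move=> [z1 z1'] [z2 z2'] /= _ _ [-> ->].
Qed.

Lemma mem_border S z z' : (z, z') \in border S = [&& z \in S, z' \in nbrs z & z' \notin S].
Proof.
apply/allpairsPdep/and3P.
  by move=> [x [y [xS]]]; rewrite mem_filter => /andP[yS yx] [-> ->].
by move=> [zS z'z z'S]; exists z, z'; rewrite mem_filter zS z'z z'S.
Qed.

Lemma border_exits (S : seq pt) (D : pt -> pt -> bool) (T : finType) (A : {set T}) (g : T -> pt * pt) :
  uniq S -> (forall z z', z' \in nbrs z -> D z z' = D z' z) ->
  (forall z, \big[addb/false]_(z' <- nbrs z) D z z' = false) ->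
  {in A &, injective g} -> (forall t, t \in A -> g t \in border S) ->
  (forall q, q \in border S -> D q.1 q.2 -> exists2 t, t \in A & q = g t) ->
  \big[addb/false]_(t in A) D (g t).1 (g t).2 = false.
Proof.
move=> uS sD hD gi gA Dg.
apply: etrans (border_sum uS sD hD); rewrite -big_enum !big_addb_odd -!size_filter; congr odd.
rewrite -(size_map g); apply: perm_size; apply: uniq_perm.
- rewrite map_inj_in_uniq; first exact: (filter_uniq _ (enum_uniq _)).
  have inF t : t \in [seq t <- enum A | D (g t).1 (g t).2] = (D (g t).1 (g t).2 && (t \in A)).
    by rewrite mem_filter mem_enum.
  move=> t t'; rewrite !inF => /andP[_ tA] /andP[_ t'A]; exact: gi.
- by rewrite filter_uniq ?uniq_border.
move=> q; rewrite mem_filter; apply/mapP/andP.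
  case=> t; rewrite mem_filter mem_enum => /andP[/= Dt tA] ->.
  by rewrite gA.
by case=> /= Dq /Dg/(_ Dq)[t tA qE]; exists t; rewrite // mem_filter mem_enum tA /= -qE Dq.
Qed.
End Grid.

(** * Faces of a grid drawing as linear forms on even edge sets *)

Section MacLane.
Notation pt := (int * int)%type.
Variables (V E : finType) (src tgt : E -> V).

Definition incident e v := (src e == v) || (tgt e == v).
Definition odd_verts (C : {set E}) := [set v | odd #|[set e in C | incident e v]|].
Definition cover_verts (C : {set E}) := [set v | [exists e in C, incident e v]].

(* A vertex is a finite set of grid points, with a path inside it from its
   center to each of its points. An edge is a lazy grid walk that leaves the box
   of one end at once and enters the box of the other end at its last step. *)
Record grid_drawing := GridDrawing {
  gbox : V -> seq pt;
  gcenter : V -> pt;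
  glen : E -> nat;
  gwalk : E -> nat -> pt;
  loopless : forall e, src e != tgt e;
  box_uniq : forall v, uniq (gbox v);
  box_disj : forall u v z, z \in gbox u -> z \in gbox v -> u = v;
  box_star : forall v z z', z \in gbox v ->
    in_seg (gcenter v, ((gcenter v).1, z.2)) z' || in_seg (((gcenter v).1, z.2), z) z' ->
    z' \in gbox v;
  walk_src : forall e, gwalk e 0 \in gbox (src e);
  walk_tgt : forall e, gwalk e (glen e) \in gbox (tgt e);
  walk_len : forall e, (1 < glen e)%N;
  walk_step : forall e i, (i < glen e)%N -> step (gwalk e i) (gwalk e i.+1);
  walk_out : forall e i v, (0 < i < glen e)%N -> gwalk e i \notin gbox v;
  walk_disj : forall e e' i j, (0 < i < glen e)%N -> (0 < j < glen e')%N ->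
    gwalk e i = gwalk e' j -> e = e' }.

Variable G : grid_drawing.
Notation box := (gbox G). Notation center := (gcenter G).
Notation len := (glen G). Notation walk := (gwalk G).

(** [box_star] keeps this L-shaped path inside the box. In [chain] the elbow at the target is not
    reversed, as orientation does not affect parities. *)
Let elbow v (z : pt) : seq (pt * pt) :=
  [:: (center v, ((center v).1, z.2)); (((center v).1, z.2), z)].
Let steps e := [seq (walk e i, walk e i.+1) | i <- iota 0 (len e)].
Let chain e := elbow (src e) (walk e 0) ++ steps e ++ elbow (tgt e) (walk e (len e)).
Let cross_par e p := \big[addb/false]_(m <- chain e) crosses m p.
Let cover_par e z z' := \big[addb/false]_(m <- chain e) covers m z z'.

Let chain_axis e : all axis (chain e).
Proof.
rewrite !all_cat /= /axis /= !eqxx ?orbT /=; apply/andP; split=> //.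
apply/allP => m /mapP[i]; rewrite mem_iota add0n => /= il ->.
exact/step_axis/walk_step.
Qed.

Let chain_ends e (f : pt -> bool) : \big[addb/false]_(m <- chain e) (f m.1 (+) f m.2) =
  f (center (src e)) (+) f (center (tgt e)).
Proof.
have tele n : (n <= len e)%N ->
    \big[addb/false]_(m <- [seq (walk e i, walk e i.+1) | i <- iota 0 n]) (f m.1 (+) f m.2)
    = f (walk e 0) (+) f (walk e n).
  elim: n => [|n IH] nl; first by rewrite big_nil addbb.
  rewrite -addn1 iotaD map_cat big_cat /= IH ?(ltnW nl) // big_seq1 /= add0n addn1.
  by case: (f (walk e 0)); case: (f (walk e n)); case: (f (walk e n.+1)).
rewrite !big_cat tele // !big_cons !big_nil /=.
case: (f (center (src e))); case: (f (center (tgt e))); case: (f (walk e 0));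
  by case: (f (walk e (len e))); do 2?case: (f (_, _)).
Qed.

Let cross_side e z z' : z' \in nbrs z ->
  cross_par e (side1 z z') (+) cross_par e (side2 z z') =
  cover_par e z z' (+) (end_term z z' (center (src e)) (+) end_term z z' (center (tgt e))).
Proof.
move=> zz; rewrite -chain_ends /cross_par /cover_par -!big_split /= !big_seq.
by apply: eq_bigr => m /(allP (chain_axis e)) ax; apply: crosses_side.
Qed.

Let chain_covers e z z' m : m \in chain e -> z' \in nbrs z -> covers m z z' ->
  (exists v, z \in box v /\ z' \in box v) \/
  (exists2 i, (i < len e)%N & (z = walk e i /\ z' = walk e i.+1) \/ (z = walk e i.+1 /\ z' = walk e i)).
Proof.
move=> mc zz cm; have /andP[sz sz'] := covers_in_seg (allP (chain_axis e) _ mc) zz cm.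
have inbox v q : q \in box v -> m \in elbow v q -> z \in box v /\ z' \in box v.
  by move=> qv; rewrite !inE => /orP[]/eqP mE; split; apply: (box_star qv);
    rewrite -mE ?sz ?sz' ?orbT.
move: mc; rewrite !mem_cat => /or3P[mc|/mapP[i]|mc].
- by left; exists (src e); apply: inbox mc; apply: walk_src.
- rewrite mem_iota add0n => /= il mE; right; exists i => //.
  by apply: covers_step; rewrite -?mE //; apply: walk_step.
- by left; exists (tgt e); apply: inbox mc; apply: walk_tgt.
Qed.

Let cover_mem e z z' : cover_par e z z' -> exists2 m, m \in chain e & covers m z z'.
Proof.
move=> h; apply/hasP; apply: contraTT h => /hasPn nc.
by rewrite /cover_par big_seq big1 // => m /nc/negbTE.
Qed.

(** The step between the box of an end [v] and the interior of the walk, oriented away from the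
    box. *)
Definition exit e v := if src e == v then (walk e 0, walk e 1)
  else (walk e (len e), walk e (len e).-1).

Let walk_ends e i v : (i <= len e)%N -> walk e i \in box v ->
  (i = 0%N /\ v = src e) \/ (i = len e /\ v = tgt e).
Proof.
move=> il iv; case: (posnP i) => [i0|i0].
  by left; split=> //; apply: box_disj iv _; rewrite i0; apply: walk_src.
right; move: il; rewrite leq_eqVlt => /orP[/eqP il|il].
  by split=> //; apply: box_disj iv _; rewrite il; apply: walk_tgt.
by have := @walk_out G e i v; rewrite i0 il iv => /(_ isT).
Qed.

Let len0 e : (0 < len e)%N. Proof. exact: ltnW (walk_len G e). Qed.
Let lenP e : (0 < (len e).-1 < len e)%N.
Proof. by have := walk_len G e; case: (len e) => [|[|n]] //= _; rewrite ltnSn. Qed.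

Let step_nbrs z z' : step z z' -> z != z' -> z' \in nbrs z.
Proof. by case/orP => // /eqP ->; rewrite eqxx. Qed.

Let exit_border e v : incident e v -> exit e v \in border (box v).
Proof.
rewrite /incident /exit; case: eqP => [<- _|_ /= /eqP <-]; rewrite mem_border.
  have o1 := @walk_out G e 1 (src e) (walk_len G e).
  rewrite walk_src o1 /= andbT; apply: step_nbrs; first exact: walk_step.
  by apply: contraNneq o1 => <-; apply: walk_src.
have o1 := @walk_out G e (len e).-1 (tgt e) (lenP e).
rewrite walk_tgt o1 /= andbT mem_nbrs_sym; apply: step_nbrs.
  by have := @walk_step G e (len e).-1; rewrite (prednK (len0 e)); apply.
by apply: contraNneq o1 => ->; apply: walk_tgt.
Qed.

Let exit_inj e e' v : incident e v -> incident e' v -> exit e v = exit e' v -> e = e'.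
Proof.
move=> _ _ ee; have [i [il ei]] : exists i, (0 < i < len e)%N /\ (exit e v).2 = walk e i.
  by rewrite /exit; case: ifP => _; [exists 1%N | exists (len e).-1]; rewrite ?walk_len ?lenP.
have [j [jl ej]] : exists j, (0 < j < len e')%N /\ (exit e' v).2 = walk e' j.
  by rewrite /exit; case: ifP => _; [exists 1%N | exists (len e').-1]; rewrite ?walk_len ?lenP.
by apply: (walk_disj il jl); rewrite -ei -ej ee.
Qed.

(** Boxes are disjoint and a walk avoids all of them except at its ends, so a chain crosses the
    border of a box only at an exit. *)
Let cover_exit e v z z' : (z, z') \in border (box v) -> cover_par e z z' ->
  incident e v /\ (z, z') = exit e v.
Proof.
rewrite mem_border => /and3P[zv zz z'v] /cover_mem[m mc cm].
case: (chain_covers mc zz cm) => [[u [zu z'u]]|[i il]].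
  by move: z'v; rewrite (box_disj zv zu) z'u.
rewrite /incident /exit; case=> -[zE z'E]; rewrite zE in zv; rewrite z'E in z'v.
  case: (walk_ends (ltnW il) zv) => -[i0 ->].
    by rewrite eqxx zE z'E i0.
  by rewrite i0 ltnn in il.
case: (walk_ends il zv) => -[i0 ->] //.
by rewrite (negbTE (loopless G e)) eqxx zE z'E -i0.
Qed.

Let cover_own e : cover_par e (walk e 0) (walk e 1).
Proof.
have := @exit_border e (src e); rewrite /exit /incident eqxx => /(_ isT).
rewrite mem_border => /and3P[zv zz z'v].
have noelbow v q : q \in box v ->
    \big[addb/false]_(m <- elbow v q) covers m (walk e 0) (walk e 1) = false.
  move=> qv; rewrite big_seq big1 // => m me; apply/negbTE/negP => cm.
  have ax : axis m by move: me; rewrite !inE => /orP[]/eqP ->; rewrite /axis /= eqxx ?orbT.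
  have /andP[_ sz'] := covers_in_seg ax zz cm.
  have : walk e 1 \in box v.
    by move: me; rewrite !inE => /orP[]/eqP mE; apply: (box_star qv); rewrite -mE sz' ?orbT.
  exact/negP/walk_out/walk_len.
rewrite /cover_par !big_cat !noelbow ?walk_src ?walk_tgt //= addbF.
rewrite big_map -(prednK (len0 e)) /= big_cons covers_self //= big_seq big1 // => i.
rewrite mem_iota => /andP[i0 il]; apply/negbTE/negP => ci.
have il' : (i < len e)%N by have := len0 e; lia.
case: (covers_step (walk_step il') zz ci) => -[e1 e2].
  by have := @walk_out G e i (src e); rewrite -e1 walk_src i0 il' => /(_ isT).
have : walk e i.+1 \in box (src e) by rewrite -e1 walk_src.
case/(walk_ends il') => -[] // _ e3.
by have := loopless G e; rewrite -e3 eqxx.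
Qed.

(** The first step of the walk of [e] thus reads off the coordinate of [e] in an edge set. *)
Let cover_other e e' : cover_par e' (walk e 0) (walk e 1) = (e' == e).
Proof.
case: eqP => [->|ne]; first exact: cover_own.
apply/negbTE/negP => c; apply: ne.
have b : (walk e 0, walk e 1) \in border (box (src e)).
  by have := @exit_border e (src e); rewrite /exit /incident eqxx => /(_ isT).
have [inc ex] := cover_exit b c.
by apply: (@exit_inj e' e (src e) inc); rewrite -?ex /incident /exit ?eqxx.
Qed.

(** Each vertex [v] contributes [f v] as often as its degree in [C], which is even. *)
Lemma even_ends (C : {set E}) (f : V -> bool) : odd_verts C = set0 ->
  \big[addb/false]_(e in C) (f (src e) (+) f (tgt e)) = false.
Proof.
move=> eC; have st e := loopless G e.
have inc e : f (src e) (+) f (tgt e) = \big[addb/false]_v (incident e v && f v).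
  rewrite (bigD1 (src e)) //= (bigD1 (tgt e)) /=; last by rewrite eq_sym st.
  rewrite /incident !eqxx orbT big1 ?addbF // => v /andP[vs vt].
  by rewrite eq_sym (negbTE vs) eq_sym (negbTE vt).
rewrite (eq_bigr _ (fun e _ => inc e)) exchange_big big1 // => v _.
case: (f v); last by rewrite big1 // => e _; rewrite andbF.
rewrite (eq_bigr (fun e => incident e v)) => [|e _]; last by rewrite andbT.
rewrite big_addb_card; apply/negbTE; have : v \notin odd_verts C by rewrite eC inE.
by rewrite inE.
Qed.

Let even_cross (C : {set E}) z z' : odd_verts C = set0 -> z' \in nbrs z ->
  \big[addb/false]_(e in C) cross_par e (side1 z z') (+)
  \big[addb/false]_(e in C) cross_par e (side2 z z') =
  \big[addb/false]_(e in C) cover_par e z z'.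
Proof.
move=> eC zz; rewrite -big_split /= (eq_bigr _ (fun e _ => cross_side e zz)) big_split /=.
by rewrite (even_ends (fun v => end_term z z' (center v)) eC) addbF.
Qed.

Section Faces.
Variable X : {set E}.

(* A face is seen through the even subsets of [X] that wind around it. *)
Definition face p : {set {set E}} := [set C : {set E} |
  [&& C \subset X, odd_verts C == set0 & \big[addb/false]_(e in C) cross_par e p]].
Definition changes (F : {set {set E}}) z z' :=
  (face (side1 z z') == F) (+) (face (side2 z z') == F).
(** The two sides of an edge are tested at the first step of its walk; the last step gives the same
    answer, as shown inside [boundary_even]. *)
Definition boundary F := [set e in X | changes F (walk e 0) (walk e 1)].

Let changes_sym F z z' : z' \in nbrs z -> changes F z z' = changes F z' z.
Proof. by move=> zz; rewrite /changes; have [-> ->] := side_sym zz. Qed.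

(** The four squares around a grid point form a cycle, and a cycle has an even number of changes. *)
Let changes_around F z : \big[addb/false]_(z' <- nbrs z) changes F z z' = false.
Proof.
case: z => x y; rewrite /nbrs !big_cons big_nil addbF /changes /side1 /side2 /lo /=.
have -> : (x == x + 1)%R = false by lia.
have -> : (x == x - 1)%R = false by lia.
have -> : (x <= x + 1)%R by lia.
have -> : (x <= x - 1)%R = false by lia.
have -> : (y <= y + 1)%R by lia.
have -> : (y <= y - 1)%R = false by lia.
rewrite eqxx.
case: (face (x, (y - 1)%R) == F); case: (face (x, y) == F);
  case: (face ((x - 1)%R, y) == F); by case: (face _ == F).
Qed.

(** Otherwise [even_cross] gives every even subset of [X] the same parity on both sides, and the two
    faces coincide. *)
Let changes_cover F z z' : z' \in nbrs z -> changes F z z' ->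
  exists2 e, e \in X & cover_par e z z'.
Proof.
move=> zz ch; have : face (side1 z z') != face (side2 z z').
  by apply: contraTneq ch => e; rewrite /changes e addbb.
move=> ne; apply/exists_inP; apply: contraR ne => /exists_inPn nc.
apply/eqP/setP => C; rewrite !inE; case: (boolP (C \subset X)) => //= CX.
case: eqP => //= eC; have := even_cross eC zz; rewrite [RHS]big1.
  by case: (\big[_/_]_(e in C) _); case: (\big[_/_]_(e in C) _).
by move=> e /(subsetP CX)/nc/negbTE.
Qed.

(** Applied to the box of [v], [border_exits] shows that [changes F] holds at an even number of
    exits. *)
Let boundary_even F : odd_verts (boundary F) = set0.
Proof.
apply/setP => v; rewrite !inE; apply/negbTE.
have := @border_exits (box v) (changes F) E [set e in X | incident e v] (fun e => exit e v)
  (box_uniq G v) (changes_sym F) (changes_around F).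
(* [changes F] agrees at both ends of an edge: apply [border_exits] to the set of interior points of
   the walk, on whose border changes can occur only at the first and the last step. *)
have ends e : e \in X -> incident e v ->
    changes F (exit e v).1 (exit e v).2 = changes F (walk e 0) (walk e 1).
  move=> eX; rewrite /incident /exit; case: eqP => //= _ _.
  pose S := undup [seq walk e i | i <- iota 1 (len e).-1].
  have inS z : reflect (exists2 i, (0 < i < len e)%N & z = walk e i) (z \in S).
    rewrite mem_undup; apply: (iffP mapP) => -[i].
      by rewrite mem_iota add1n prednK // => ? ->; exists i.
    by move=> il ->; exists i; rewrite // mem_iota add1n prednK.
  have w1 : walk e 1 \in S by apply/inS; exists 1%N; rewrite // walk_len.
  have w2 : walk e (len e).-1 \in S by apply/inS; exists (len e).-1.
  have wout u z : z \in box u -> z \notin S.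
    by move=> zu; apply/inS => -[i il zE]; move: (walk_out u il); rewrite -zE zu.
  have b0 : (walk e 1, walk e 0) \in border S.
    rewrite mem_border w1 (wout (src e)) ?walk_src // andbT mem_nbrs_sym.
    have := @exit_border e (src e); rewrite /exit /incident eqxx => /(_ isT).
    by rewrite mem_border => /and3P[].
  have b1 : (walk e (len e).-1, walk e (len e)) \in border S.
    rewrite mem_border w2 (wout (tgt e)) ?walk_tgt // andbT mem_nbrs_sym.
    have := @exit_border e (tgt e); rewrite /exit /incident (negbTE (loopless G e)) eqxx.
    by move/(_ isT); rewrite mem_border => /and3P[].
  pose g (t : bool) := if t then (walk e 1, walk e 0) else (walk e (len e).-1, walk e (len e)).
  have := @border_exits S (changes F) bool setT g (undup_uniq _) (changes_sym F) (changes_around F).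
  rewrite (eq_bigl xpredT) => [|t]; last by rewrite in_setT.
  rewrite big_bool /= => sum0.
  have /eqP : changes F (walk e 1) (walk e 0) (+) changes F (walk e (len e).-1) (walk e (len e)) = false.
    apply: sum0.
    - move=> [] [] _ _ //= [_ h].
        have : src e = tgt e by apply: (@box_disj G _ _ (walk e 0)); rewrite ?walk_src // h walk_tgt.
        by move/eqP; rewrite (negbTE (loopless G e)).
      have : src e = tgt e by apply: (@box_disj G _ _ (walk e 0)); rewrite ?walk_src // -h walk_tgt.
      by move/eqP; rewrite (negbTE (loopless G e)).
    - by case.
    move=> [z z'] zb /= ch; move: (zb); rewrite mem_border => /and3P[zS zz z'S].
    have [e' e'X ce] := changes_cover zz ch; have [m mc cm] := cover_mem ce.
    have /inS[i il zE] := zS.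
    case: (chain_covers mc zz cm) => [[u [zu _]]|[j jl zj]].
      by move: (walk_out u il); rewrite -zE zu.
    have ee : e' = e.
      case: zj => -[zj _].
        case: (posnP j) => [j0|j0].
          by move: (walk_out (src e') il); rewrite -zE zj j0 walk_src.
        by apply/esym; apply: (walk_disj il (_ : 0 < j < len e')%N); rewrite ?j0 // -zE.
      move: jl; rewrite leq_eqVlt => /orP[/eqP jl|jl].
        by move: (walk_out (tgt e') il); rewrite -zE zj jl walk_tgt.
      by apply/esym; apply: (walk_disj il (_ : 0 < j.+1 < len e')%N); rewrite // -zE.
    subst e'.
    have z'ends : z' = walk e j -> j = 0%N.
      move=> z'E; apply/eqP; rewrite -leqn0 leqNgt; apply/negP => j0.
      by case/inS: z'S; exists j; rewrite ?j0.
    have z'ende : z' = walk e j.+1 -> j.+1 = len e.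
      move=> z'E; apply/eqP; rewrite eqn_leq jl leqNgt; apply/negP => j1.
      by case/inS: z'S; exists j.+1.
    case: zj => -[zj z'j].
      by exists false; rewrite ?in_setT //= -(z'ende z'j) -z'j -zj.
    by exists true; rewrite ?in_setT //= -(z'ends z'j) -z'j -zj.
  rewrite eqbF_neg negb_add => /eqP h; rewrite (changes_sym F (z := walk e 0)); last first.
    have := @exit_border e (src e); rewrite /exit /incident eqxx => /(_ isT).
    by rewrite mem_border => /and3P[].
  rewrite h changes_sym //.
  by move: b1; rewrite mem_border mem_nbrs_sym => /and3P[].
move=> sum0; rewrite [X in odd X](_ : _ = #|[set e in [set e in X | incident e v] |
    changes F (exit e v).1 (exit e v).2]|).
  rewrite -big_addb_card; apply/negbT/sum0.
  - by move=> e e'; rewrite !inE => /andP[_ ie] /andP[_ ie']; apply: exit_inj.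
  - by move=> e; rewrite inE => /andP[_]; apply: exit_border.
  move=> [z z'] zb ch; have := zb; rewrite mem_border => /and3P[_ zz _].
  have [e eX ce] := changes_cover zz ch; have [ie ez] := cover_exit zb ce.
  by exists e; rewrite // inE eX.
apply: eq_card => e; rewrite !inE; case: (boolP (e \in X)) => //= eX.
by case: (boolP (incident e v)) => [ie|]; rewrite ?andbF ?andbT //= ends.
Qed.

Let boundary_faces F e : e \in boundary F ->
  (F == face (side1 (walk e 0) (walk e 1))) || (F == face (side2 (walk e 0) (walk e 1))).
Proof.
rewrite inE /changes => /andP[_]; rewrite ![F == _]eq_sym.
by case: (_ == F); case: (_ == F).
Qed.

Let boundary_le2 e : #|[set F | e \in boundary F]| <= 2.
Proof.
set f1 := face (side1 (walk e 0) (walk e 1)); set f2 := face (side2 (walk e 0) (walk e 1)).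
apply: (@leq_trans #|[set f1; f2]|); last by rewrite cards2; case: (_ == _).
apply: subset_leq_card; apply/subsetP => F.
by rewrite in_set => /boundary_faces h; rewrite !inE.
Qed.

Let bdry_sub (C : {set E}) : C \subset X -> odd_verts C \subset cover_verts X.
Proof.
move=> CX; apply/subsetP => v; rewrite !inE => ov.
have : [set e in C | incident e v] != set0.
  by apply: contraTneq ov => ->; rewrite cards0.
by case/set0Pn => e; rewrite inE => /andP[eC ie]; apply/exists_inP; exists e; rewrite // (subsetP CX).
Qed.

Let symdiff_sum (C1 C2 : {set E}) (f : E -> bool) :
  \big[addb/false]_(e in (C1 :\: C2) :|: (C2 :\: C1)) f e =
  \big[addb/false]_(e in C1) f e (+) \big[addb/false]_(e in C2) f e.
Proof.
rewrite big_mkcond [X in _ = X (+) _]big_mkcond [X in _ = _ (+) X]big_mkcond -big_split /=.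
apply: eq_bigr => e _; rewrite !inE.
by case: (e \in C1); case: (e \in C2); case: (f e).
Qed.

Let symdiff_odd (C1 C2 : {set E}) v :
  (v \in odd_verts ((C1 :\: C2) :|: (C2 :\: C1))) = (v \in odd_verts C1) (+) (v \in odd_verts C2).
Proof. by rewrite !inE -!big_addb_card symdiff_sum. Qed.

(** The number of vertices of odd degree is even, so it cannot be 1. *)
Let handshake (C : {set E}) w0 : odd_verts C \subset [set w0] -> odd_verts C = set0.
Proof.
move=> sub; have total : \big[addb/false]_v (v \in odd_verts C) = false.
  rewrite (eq_bigr (fun v => \big[addb/false]_(e in C) incident e v)) => [|v _]; last first.
    by rewrite inE -big_addb_card.
  rewrite exchange_big big1 // => e _.
  rewrite (bigD1 (src e)) //= (bigD1 (tgt e)) /=; last by rewrite eq_sym loopless.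
  rewrite /incident !eqxx orbT big1 // => v /andP[vs vt].
  by rewrite eq_sym (negbTE vs) eq_sym (negbTE vt).
apply/setP => v; rewrite [RHS]inE; apply/negP => vC.
have vw : v = w0 by move/(subsetP sub): vC; rewrite inE => /eqP.
move: total; rewrite (bigD1 v) //= vC big1 // => u uv.
by apply/negP => /(subsetP sub); rewrite inE -vw (negbTE uv).
Qed.

(* Every even set inside [X] on which the faces next to [X] all agree is empty:
   with the evenness conditions at the vertices this bounds the number of edges. *)
Theorem grid_maclane : 0 < #|X| -> #|cover_verts X| <= #|X| ->
  exists (F : {set {set {set E}}}) (B : {set {set E}} -> {set E}),
  [/\ forall f, f \in F -> [/\ B f != set0, B f \subset X & odd_verts (B f) = set0],
      forall e, #|[set f in F | e \in B f]| <= 2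
    & #|X| + 2 <= #|F| + #|cover_verts X|].
Proof.
move=> X0 WX; set W := cover_verts X in WX *.
pose F := [set f | boundary f != set0].
exists F, boundary; split=> [f|e|].
- rewrite inE => fF; split=> //; try exact: boundary_even.
  by apply/subsetP => e; rewrite in_set => /andP[].
- by apply: leq_trans (boundary_le2 e); apply: subset_leq_card; apply/subsetP => f; rewrite !inE => /andP[].
have [e0 e0X] : exists e, e \in X by apply/set0Pn; rewrite -card_gt0.
pose w0 := src e0.
have w0W : w0 \in W by rewrite inE; apply/exists_inP; exists e0; rewrite // /incident eqxx.
have [rep repP] : exists rep : {set {set E}} -> pt, forall f, f \in F -> face (rep f) = f.
  suff /fin_all_exists[rep h] : forall f, exists p, f \in F -> face p = f by exists rep.
  move=> f; case: (boolP (f \in F)) => [|_]; last by exists (0%R, 0%R).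
  rewrite inE => /set0Pn[e /boundary_faces/orP[]/eqP ->].
    by exists (side1 (walk e 0) (walk e 1)).
  by exists (side2 (walk e 0) (walk e 1)).
pose par f (C : {set E}) := \big[addb/false]_(e in C) cross_par e (rep f).
have [f0 cF] : exists f0, 0 < #|F| -> f0 \in F.
  by case: (set_0Vmem F) => [->|[f0 f0F]]; [exists set0; rewrite cards0 | exists f0].
(* If [code] is injective and [F] is nonempty, counting gives [#|X| <= (#|W| - 1) + (#|F| - 1)]. The
   parity at [w0] follows from the others, and [f0] is the reference face. *)
pose code (C : {set E}) := (odd_verts C :\ w0, [set f in F :\ f0 | par f C != par f0 C]).
have code_inj : {in powerset X &, injective code}.
  move=> C1 C2; rewrite !inE => C1X C2X [/setP eV /setP eF].
  pose C := (C1 :\: C2) :|: (C2 :\: C1).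
  have CX : C \subset X.
    by rewrite subUset !(subset_trans (subsetDl _ _)).
  have eC : odd_verts C = set0.
    apply: (@handshake C w0); apply/subsetP => v; rewrite symdiff_odd inE => ov.
    apply: contraTT ov => vw; have := eV v; rewrite !inE vw /= -!big_addb_card => ->.
    by rewrite addbb.
  have parC f : par f C = par f C1 (+) par f C2 by apply: symdiff_sum.
  have agree f : f \in F -> par f C = par f0 C.
    move=> fF; case: (eqVneq f f0) => [->//|ff0].
    have := eF f; rewrite !inE ff0 /=.
    have := fF; rewrite inE => -> /=; rewrite !parC.
    by case: (par f C1); case: (par f C2); case: (par f0 C1); case: (par f0 C2).
  (* An edge of [C] would have a face containing [C] on one side and a face not containing it on the
     other, but all faces in [F] agree on [C]. *)
  have C0 : C = set0.
    apply/setP => e; rewrite [RHS]inE; apply/negP => eC'.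
    have eX := subsetP CX e eC'.
    have := @exit_border e (src e); rewrite /exit /incident eqxx => /(_ isT).
    rewrite mem_border => /and3P[_ zz _].
    have cov1 : \big[addb/false]_(e' in C) cover_par e' (walk e 0) (walk e 1) = true.
      rewrite (bigD1 e) //= cover_own big1 // => e' /andP[_ ee'].
      by rewrite cover_other (negbTE ee').
    have := even_cross eC zz; rewrite cov1.
    have inface p : (C \in face p) = \big[addb/false]_(e in C) cross_par e p.
      by rewrite inE CX eC eqxx.
    have faceF f : f \in F -> (C \in f) = par f0 C.
      by move=> fF; rewrite -{1}(repP f fF) inface -(agree f fF).
    rewrite -!inface => ne.
    have nef : face (side1 (walk e 0) (walk e 1)) != face (side2 (walk e 0) (walk e 1)).
      by apply: contraTneq isT => ee; move: ne; rewrite ee addbb.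
    have F1 : face (side1 (walk e 0) (walk e 1)) \in F.
      rewrite inE; apply/set0Pn; exists e; rewrite inE eX /changes eqxx.
      by rewrite eq_sym (negbTE nef).
    have F2 : face (side2 (walk e 0) (walk e 1)) \in F.
      by rewrite inE; apply/set0Pn; exists e; rewrite inE eX /changes eqxx (negbTE nef).
    by move: ne; rewrite !faceF // addbb.
  apply/setP => e; move/setP/(_ e): C0; rewrite !inE.
  by case: (e \in C1); case: (e \in C2).
have : #|[set code C | C in powerset X]| <= #|setX (powerset (W :\ w0)) (powerset (F :\ f0))|.
  apply: subset_leq_card; apply/subsetP => _ /imsetP[C CX ->]; rewrite powersetE in CX.
  rewrite in_setX !powersetE; apply/andP; split; first exact: setSD _ (bdry_sub CX).
  by apply/subsetP => f; rewrite in_set => /andP[].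
rewrite card_in_imset // cardsX !card_powerset -expnD leq_exp2l //.
move: WX; rewrite (cardsD1 w0 W) w0W => WX.
(* Without any face the count would give [#|X| < #|W|], contrary to [WX]. *)
case: (posnP #|F|) => [F0|/cF f0F].
  have -> : #|F :\ f0| = 0 by apply/eqP; rewrite -leqn0 -F0 subset_leq_card ?subD1set.
  by move: WX; lia.
by rewrite (cardsD1 f0 F) f0F; lia.
Qed.
End Faces.
End MacLane.

(** * Threads in graphs of large girth *)

Section Runs.
Variable T : eqType.
Implicit Types (P : pred T) (s c : seq T).

Lemma count_blocks P n m s :
  (forall j, j < m -> has P (take n (drop (j * n) s))) -> m <= count P s.
Proof.
elim: m s => // m IH s h; rewrite -(cat_take_drop n s) count_cat.
have h0 : 0 < count P (take n s) by rewrite -has_count; have := h 0 isT; rewrite mul0n drop0.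
have := IH (drop n s); rewrite -add1n => h1; apply: leq_add => //; apply: h1 => j jm.
by rewrite drop_drop -mulSnr; apply: h.
Qed.

(** After a rotation to an element of [P], at most four others remain for five disjoint blocks of
    length [n]. The head is dropped to keep a vertex in front of the run. *)
Lemma long_run P n c : 5 * n < size c -> count P c <= 5 ->
  exists m, all (predC P) (take n (behead (rot m c))).
Proof.
move=> sc cP; case: (boolP (has P c)) => [hP|nP]; last first.
  exists 0; apply/allP => x; rewrite rot0 => /mem_take/mem_behead xc.
  exact: (hasPn nP).
have /hasP[x xc Px] := hP; case: (rot_to xc) => k s rE.
have ss : (size s).+1 = size c by rewrite -(size_rot k c) rE.
have cs : count P s <= 4.
  have /permP/(_ P) : perm_eq (rot k c) c by rewrite perm_rot.
  by rewrite rE /= Px; lia.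
case: (boolP [forall j : 'I_5, has P (take n (drop (j * n) s))]) => [/forallP h|].
  suff : 5 <= count P s by lia.
  by apply: (@count_blocks P n) => j j5; apply: (h (Ordinal j5)).
case/forallPn => -[j /= j5] nj.
have jn : j * n + n <= size s.
  by apply: leq_trans (_ : 5 * n <= _); [rewrite -mulSnr leq_mul2r j5 orbT | lia].
have [m mE] : exists m, rot m c = rot (j * n) (rot k c).
  case: (leqP k (size c)) => kc; last by exists (j * n); rewrite (rot_oversize (ltnW kc)).
  by rewrite rot_add_mod //; [eexists | lia].
exists m; rewrite mE rE.
rewrite /rot (drop_nth x) /=; last by lia.
rewrite takel_cat ?size_drop; last by lia.
by apply/allP => y yt; apply: (hasPn nj).
Qed.
End Runs.

Section Cycle.
Variables (V : finType) (r : rel V).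
Hypotheses (sr : symmetric r) (ir : irreflexive r).

(** A path is extended at its front until the new vertex already lies on it. *)
Lemma cycle_of_min_degree2 x y : r x y ->
  (forall x y, r x y -> exists2 z, z != x & r y z) ->
  exists c, 2 < size c /\ ucycle r c.
Proof.
move=> xy nxt.
suff ext m p u v : path r u (v :: p) -> uniq [:: u, v & p] -> #|V| <= size p + m ->
    exists c, 2 < size c /\ ucycle r c.
  apply: (ext #|V| [::] x y); rewrite /= ?xy ?inE ?andbT //.
  by apply: contraTneq xy => ->; rewrite ir.
elim: m p u v => [|m IH] p u v pu uu cV.
  have := card_uniqP uu; have := max_card (mem [:: u, v & p]).
  by move=> h1 h2; rewrite h2 in h1; move: h1 cV => /=; lia.
have vu : r v u by move: pu => /= /andP[uv _]; rewrite sr.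
have [z zv uz] := nxt v u vu.
have zu : z != u by apply: contraTneq uz => ->; rewrite ir.
case: (boolP (z \in p)) => [zp|zp]; last first.
  apply: (IH (v :: p) z u).
  - by rewrite [path _ _ _]/= sr uz.
  - by rewrite cons_uniq uu andbT !inE !negb_or zu zv zp.
  - by rewrite /= addSnnS.
case/splitPr: zp pu uu => p1 p2 pu uu.
exists [:: u, v & rcons p1 z]; split; first by rewrite /= size_rcons.
apply/andP; split.
  move: pu; rewrite /= -cat_rcons cat_path => /and3P[-> pv _] /=.
  by rewrite rcons_path pv /= last_rcons sr.
by move: uu; rewrite -cat_rcons -!cat_cons cat_uniq => /andP[].
Qed.
End Cycle.

Section Threads.
Variables (V E : finType) (src tgt : E -> V) (adj : rel V).
Hypothesis (adj_irr : irreflexive adj).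
Hypothesis (adj_edge : forall e, adj (src e) (tgt e)).
Hypothesis (edge_adj : forall x y, adj x y ->
  exists e, (src e = x /\ tgt e = y) \/ (src e = y /\ tgt e = x)).
Hypothesis (edge_inj : injective (fun e => [set src e; tgt e])).
Variable G : grid_drawing src tgt.
Variable n : nat.
Hypothesis n0 : 0 < n.
Hypothesis long_cycles : forall c, 2 < size c -> ucycle adj c -> 5 * n < size c.
Notation incident := (incident src tgt).

Let other e v := if src e == v then tgt e else src e.

Let otherE e v : incident e v -> [set src e; tgt e] = [set v; other e v].
Proof.
rewrite /incident /other; case: eqP => [->//|_ /= /eqP ->].
by rewrite setUC.
Qed.

Let st e : src e != tgt e.
Proof. by apply: contraTneq (adj_edge e) => ->; rewrite adj_irr. Qed.

Section Sub.
Variable b : rel V.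
Hypotheses (sb : symmetric b) (ba : subrel b adj).
Let X := [set e | b (src e) (tgt e)].

Let b_other e v : incident e v -> b v (other e v) = (e \in X).
Proof.
by rewrite inE /incident /other; case: eqP => [<-//|_ /= /eqP <-]; rewrite sb.
Qed.

Let edge_of x y : b x y -> exists e, [/\ e \in X, incident e x & other e x = y].
Proof.
move=> xy; have [e h] := edge_adj (ba xy); exists e.
rewrite inE /incident /other.
case: h => -[<- <-] in xy *; first by rewrite !eqxx xy.
by rewrite eqxx orbT sb xy (negbTE (st e)).
Qed.

Let degreeE v : degree b v = #|[set e in X | incident e v]|.
Proof.
rewrite -(@card_in_imset _ _ (other^~ v)).
  apply: eq_card => y; rewrite inE; apply/idP/imsetP.
    by case/edge_of => e [eX ie <-]; exists e; rewrite // inE eX.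
  by case=> e; rewrite inE => /andP[eX ie] ->; rewrite b_other.
move=> e e'; rewrite !inE => /andP[_ ie] /andP[_ ie'] ee'.
by apply: edge_inj; rewrite /= (otherE ie) (otherE ie') ee'.
Qed.

Let handshake (C : {set E}) (P : pred V) :
  \sum_(v | P v) #|[set e in C | incident e v]| = \sum_(e in C) \sum_(v | P v) incident e v.
Proof.
rewrite exchange_big /=; apply: eq_bigr => v _.
rewrite -sum1_card big_mkcond [RHS]big_mkcond; apply: eq_bigr => e _.
by rewrite inE; case: (e \in C); case: (incident e v).
Qed.

Hypothesis deg2 : forall x y, b x y -> 1 < degree b x.
Let big v := 2 < degree b v.

Let thread_of_cycle c : 2 < size c -> ucycle b c -> count big c <= 5 ->
  exists w : nat -> V, [/\ forall i, i < n.+1 -> b (w i) (w i.+1),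
    forall i j, i <= n.+1 -> j <= n.+1 -> w i = w j -> i = j
    & forall i, 0 < i -> i <= n -> degree b (w i) = 2].
Proof.
move=> sc uc cc.
have lc : 5 * n < size c.
  by apply: long_cycles => //; case/andP: uc => cb u; rewrite /ucycle u (sub_cycle ba).
have [m hm] := long_run lc cc.
move: uc; rewrite -(rot_ucycle m).
have : size (rot m c) = size c by rewrite size_rot.
case: (rot m c) hm => [|x p] hm ss; first by rewrite -ss in lc.
move=> /andP[cb u].
have sp : n.+1 < size (x :: p) by rewrite ss; lia.
have w_adj i : i < n.+1 -> b (nth x (x :: p) i) (nth x (x :: p) i.+1).
  move=> ik; have ip : i < size p by move: sp => /=; lia.
  have /(pathP x)/(_ i) := cb; rewrite size_rcons => /(_ (ltnW ip)).
  by rewrite nth_rcons ip -rcons_cons nth_rcons /= ltnS (ltnW ip).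
exists (nth x (x :: p)); split=> //.
  move=> i j ik jk /eqP; rewrite nth_uniq // => [/eqP//||]; lia.
case=> // i _ ik; apply/eqP; rewrite eqn_leq (deg2 (w_adj i.+1 _)) // andbT.
have := allP hm (nth x p i); rewrite /= /big -leqNgt; apply.
rewrite -(nth_take x ik) mem_nth // size_takel //.
by move: sp => /=; lia.
Qed.

(** A vertex met by an even set has degree at least 2 in it, so [cycle_of_min_degree2] applies to
    the graph of [B]. *)
Let cycle_of_even (B : {set E}) : B \subset X -> B != set0 -> odd_verts src tgt B = set0 ->
  exists c, [/\ 2 < size c, ucycle b c & forall v, v \in c -> 1 < #|[set e in B | incident e v]|].
Proof.
move=> BX B0 eB.
pose r x y := [exists e in B, incident e x && (other e x == y)].
have oo e x : incident e x -> incident e (other e x) /\ other e (other e x) = x.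
  rewrite /incident /other; case: (eqVneq (src e) x) => [<- _|ne /= /eqP <-].
    by rewrite eqxx orbT (negbTE (st e)).
  by rewrite !eqxx.
have rb x y : r x y -> b x y.
  by case/exists_inP => e eB' /andP[ie /eqP <-]; rewrite b_other // (subsetP BX).
have rs x y : r x y -> r y x.
  case/exists_inP => e eB' /andP[ie /eqP <-]; have [h1 h2] := oo e x ie.
  by apply/exists_inP; exists e; rewrite // h1 h2 /=.
have rP v y : r v y -> 1 < #|[set e in B | incident e v]|.
  case/exists_inP => e eB' /andP[ie _].
  have : v \notin odd_verts src tgt B by rewrite eB inE.
  rewrite inE; have : 0 < #|[set e in B | incident e v]|.
    by rewrite card_gt0; apply/set0Pn; exists e; rewrite inE eB' ie.
  by case: #|_| => [|[|]].
have [e eB'] := set0Pn _ B0.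
have rst : r (src e) (tgt e).
  by apply/exists_inP; exists e; rewrite // /incident /other !eqxx.
have [||x y /rs yx|c [sc uc]] := cycle_of_min_degree2 _ _ rst.
- by move=> x y; apply/idP/idP; apply: rs.
- by move=> x; apply/negbTE/negP => /rb/ba; rewrite adj_irr.
- have /exists_inP[e1 e1B /andP[i1 /eqP o1]] := yx.
  have [e2] := card_gt1_pick e1 (rP _ _ yx); rewrite inE => /andP[e2B i2] ne.
  exists (other e2 y); last by apply/exists_inP; exists e2; rewrite // i2 /=.
  rewrite -o1; apply: contra ne => /eqP oe; apply/eqP/edge_inj.
  by rewrite /= (otherE i1) (otherE i2) oe.
exists c; split=> //.
  by case/andP: uc => cr u; rewrite /ucycle u (sub_cycle rb).
move=> v vc; case/andP: uc => cr u.
by apply: rP (next_cycle cr vc).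
Qed.

(** Let [s] be the number of vertices of degree above 2 and [D] the sum of their degrees. From
    [D = 2 * (#|X| - #|W|) + 2 * s] and [3 * s <= D] follows [D <= 6 * (#|X| - #|W|)]. If every
    [wt f] were at least 12, then [12 * #|F| <= 2 * D], against the lower bound for [#|F|]. *)
Lemma threads_of_sub : (exists x y, b x y) ->
  exists w : nat -> V, [/\ forall i, i < n.+1 -> b (w i) (w i.+1),
    forall i j, i <= n.+1 -> j <= n.+1 -> w i = w j -> i = j
    & forall i, 0 < i -> i <= n -> degree b (w i) = 2].
Proof.
move=> [x0 [y0 xy0]]; have [e0 [e0X _ _]] := edge_of xy0.
pose W := cover_verts src tgt X.
have inW v : (v \in W) = (0 < degree b v).
  rewrite inE degreeE card_gt0; apply/exists_inP/set0Pn => -[e].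
    by move=> eX ie; exists e; rewrite inE eX.
  by rewrite inE => /andP[eX ie]; exists e.
have degW v : v \in W -> 1 < degree b v.
  by rewrite inW => /card_gt0_pick[y]; rewrite inE => /deg2.
have two e : \sum_v incident e v = 2.
  rewrite (bigD1 (src e)) //= (bigD1 (tgt e)) /=; last by rewrite eq_sym st.
  rewrite /incident !eqxx orbT big1 // => v /andP[vs vt].
  by rewrite ![_ == v]eq_sym (negbTE vs) (negbTE vt).
have sumX : \sum_(v in W) degree b v = #|X| * 2.
  have out v : v \notin W -> #|[set e in X | incident e v]| = 0.
    by rewrite inW -degreeE -eqn0Ngt => /eqP.
  rewrite (eq_bigr _ (fun v _ => degreeE v)).
  transitivity (\sum_v #|[set e in X | incident e v]|).
    by rewrite [RHS](bigID (mem W)) /= [X in _ = _ + X]big1 ?addn0.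
  rewrite handshake (eq_bigr _ (fun e _ => two e)) sum_nat_const.
  by [].
have leW : #|W| <= #|X|.
  rewrite -(leq_pmul2r (isT : 0 < 2)) -sumX -sum_nat_const.
  exact: leq_sum.
have bigW v : big v -> v \in W by rewrite inW => /ltnW/ltnW.
pose D := \sum_(v | big v) degree b v.
have sumW : \sum_(v in W) degree b v + 2 * #|[set v | big v]| = D + 2 * #|W|.
  rewrite (bigID big) /= (eq_bigl big) => [|v]; last first.
    by rewrite andbC; case: (boolP (big v)) => // /bigW ->.
  rewrite -/D -addnA; congr (_ + _).
  rewrite (eq_bigr (fun=> 2)) => [|v /andP[vW nb]]; last first.
    by apply/eqP; rewrite eqn_leq degW // andbT leqNgt.
  rewrite sum_nat_cond_const -(cardsID [set v | big v] W).
  have -> : W :&: [set v | big v] = [set v | big v].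
    by apply/setP => v; rewrite in_setI in_set andbC; case: (boolP (big v)) => // /bigW ->.
  rewrite addnC mulnDr; congr (_ + _); rewrite mulnC; congr (_ * _).
  by apply: eq_card => v; rewrite !inE andbC.
have leD : 3 * #|[set v | big v]| <= D.
  rewrite mulnC -sum_nat_const /D (eq_bigl big) => [|v]; last by rewrite inE.
  exact: leq_sum.
have X0 : 0 < #|X| by rewrite card_gt0; apply/set0Pn; exists e0.
have [F [B [FB F2 FX]]] := grid_maclane G X0 leW.
pose wt f := \sum_(v | big v) #|[set e in B f | incident e v]|.
(* Six vertices of degree above 2 on a cycle contribute at least two edges each to the weight. *)
case: (boolP [exists f in F, wt f < 12]) => [/exists_inP[f fF wf]|/exists_inPn nF].
  have [Bf0 BfX Bfe] := FB f fF.
  have [c [sc uc c2]] := cycle_of_even BfX Bf0 Bfe.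
  apply: (thread_of_cycle sc uc); rewrite leqNgt; apply/negP => cc.
  suff : 12 <= wt f by rewrite leqNgt wf.
  have uq : uniq c by case/andP: uc.
  apply: (@leq_trans (\sum_(v in [set v in c | big v]) 2)).
    rewrite sum_nat_const -[12]/(6 * 2) leq_mul2r /=.
    rewrite (_ : #|_| = count big c) // -size_filter -(card_uniqP (filter_uniq big uq)).
    by apply: eq_card => v; rewrite inE mem_filter andbC.
  rewrite /wt [X in _ <= X](bigID (mem c)) /=.
  apply: (@leq_trans (\sum_(v | big v && (v \in c)) #|[set e in B f | incident e v]|)); last exact: leq_addr.
  rewrite (eq_bigl (fun v => big v && (v \in c))) => [|v]; last by rewrite inE andbC.
  by apply: leq_sum => v /andP[_ vc]; apply: c2.
exfalso.
have h1 : 12 * #|F| <= \sum_(f in F) wt f.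
  rewrite mulnC -sum_nat_const; apply: leq_sum => f fF.
  by rewrite leqNgt; apply: nF.
(* An edge lies in at most two boundaries, so each of its incidences is counted at most twice. *)
have h2 : \sum_(f in F) wt f <= 2 * D.
  rewrite /wt exchange_big /= /D big_distrr /=; apply: leq_sum => v _.
  rewrite degreeE.
  rewrite (eq_bigr (fun f => \sum_(e in X) (e \in B f) * incident e v)) => [|f fF]; last first.
    have [_ BfX _] := FB f fF.
    rewrite -sum1_card big_mkcond [RHS]big_mkcond; apply: eq_bigr => e _; rewrite inE.
    case: (boolP (e \in B f)) => [/(subsetP BfX) ->|_] /=; last by case: (e \in X).
    by case: (incident e v).
  rewrite exchange_big /= mulnC -sum_nat_const big_mkcond [X in _ <= X]big_mkcond /=.
  apply: leq_sum => e _; rewrite inE; case: (boolP (e \in X)) => //= eX.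
  rewrite -big_distrl /=; case: (incident e v); rewrite ?muln0 // muln1.
  suff -> : \sum_(f in F) (e \in B f) = #|[set f in F | e \in B f]| by [].
  rewrite -sum1_card [RHS]big_mkcond [LHS]big_mkcond; apply: eq_bigr => f _.
  by rewrite inE; case: (f \in F); case: (e \in B f).
move: h1 h2 FX sumX sumW leD; rewrite -/W; clear; lia.
Qed.
End Sub.

Lemma has_threads_of_drawing : has_threads n adj.
Proof. by move=> b sb ba ex deg2; apply: threads_of_sub. Qed.
End Threads.

(** * From plane drawings to grid drawings *)

Require Import Defs.
From mathcomp Require Import all_classical all_reals all_analysis.
From mathcomp Require Import lra.
Import numFieldNormedType.Exports.

Section Metric.
Local Open Scope classical_set_scope.
Local Open Scope ring_scope.
Variables (R : realType) (M : pseudoMetricType R).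

Lemma compact_closed_separated (A B : set M) : compact A -> closed B -> A `&` B = set0 ->
  exists2 e, 0 < e & forall x y, A x -> B y -> ~ ball x e y.
Proof.
move=> /compact_near_coveringP cA cB AB.
have [|e [e0 he]] := @filter_ex _ (0 : R)^'+ _ (fun e => 0 < e /\ (A `<=` fun x => forall y, B y -> ~ ball x e y)).
  apply: filterI; first exact: nbhs_right_gt.
  have FF : Filter (0 : R)^'+ by exact: _.
  apply: (cA R _ (fun e x => forall y, B y -> ~ ball x e y) FF) => x Ax.
  have : nbhs x (~` B).
    apply: open_nbhs_nbhs; split; first exact: closed_openC.
    by move=> Bx; have : (A `&` B) x by []; rewrite AB.
  move/nbhs_ballP => -[d /= d0 dB].
  exists (ball x (d / 2), [set e | e < d / 2]).
    split; first by apply: nbhsx_ballx; rewrite divr_gt0.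
    by apply: nbhs_right_lt; rewrite divr_gt0.
  move=> [x' e] /= [xx' ed] y By xy; apply: (dB y) => //.
  apply: (ball_split (z := x')) => //.
  by apply: le_ball xy; apply: ltW.
by exists e => // x y Ax By; apply: he.
Qed.

Lemma arc_uniform_continuity (f : R -> M) (d : R) : {within `[0, 1], continuous f} -> 0 < d ->
  exists2 e, 0 < e & forall s t, 0 <= s <= 1 -> 0 <= t <= 1 -> `|s - t| < e -> ball (f s) d (f t).
Proof.
move=> /subspace_continuousP cf d0.
have /compact_near_coveringP cI := @segment_compact R 0 1.
pose P (e s : R) := forall t, 0 <= t <= 1 -> 0 <= s <= 1 -> `|s - t| < e -> ball (f s) d (f t).
have [|e [e0 he]] := @filter_ex _ (0 : R)^'+ _ (fun e => 0 < e /\ (`[0, 1] `<=` P e)).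
  apply: filterI; first exact: nbhs_right_gt.
  have FF : Filter (0 : R)^'+ by exact: _.
  apply: (cI R _ P FF) => s sI.
  have : \forall t \near within `[0, 1] (nbhs s), ball (f s) (d / 2) (f t).
    by apply: (cf s sI); apply: nbhsx_ballx; rewrite divr_gt0.
  move/nbhs_ballP => -[c /= c0 cb].
  exists (ball s (c / 2), [set e | e < c / 2]).
    split; first by apply: nbhsx_ballx; rewrite divr_gt0.
    by apply: nbhs_right_lt; rewrite divr_gt0.
  move=> [s' e] /= [ss' ec] t tI s'I s't; apply: (ball_split (z := f s)).
    apply: ball_sym; apply: cb => /=; last by rewrite in_itv.
    by apply: le_ball ss'; rewrite ler_piMr ?ltW // invf_lt1 ?ltr1n.
  apply: cb => /=; last by rewrite in_itv.
  apply: (ball_split (z := s')) => //; rewrite -ball_normE /=.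
  exact: lt_trans s't ec.
by exists e => // s t sI tI st; apply: (he s) => //=.
Qed.
End Metric.

Section FiniteUniform.
Local Open Scope ring_scope.

Lemma finite_uniform (R : realType) (I : finType) (P : I -> R -> Prop) :
  (forall i e e', e' <= e -> P i e -> P i e') -> (forall i, exists2 e, 0 < e & P i e) ->
  exists2 e, 0 < e & forall i, P i e.
Proof.
move=> mP hP.
have /fin_all_exists[e he] : forall i, exists e, 0 < e /\ P i e.
  by move=> i; have [e ? ?] := hP i; exists e.
have pos i : 0 < (e i)^-1 by rewrite invr_gt0; case: (he i).
(* A positive number below every [e i] that makes sense even for empty [I]. *)
exists (1 + \sum_i (e i)^-1)^-1.
  by rewrite invr_gt0 ltr_pwDl // sumr_ge0 // => i _; apply: ltW.
move=> i; apply: (mP i (e i)); last by case: (he i).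
have ei0 : 0 < e i by case: (he i).
rewrite invf_ple ?posrE //; last by rewrite ltr_pwDl // sumr_ge0 // => j _; apply: ltW.
rewrite (bigD1 i) //= addrA [1 + _]addrC -addrA lerDl addr_ge0 // sumr_ge0 // => j _.
exact: ltW.
Qed.
End FiniteUniform.

Section Drawing.
Local Open Scope classical_set_scope.
Local Open Scope ring_scope.
Variables (R : realType) (G : sgraph).
Hypothesis planarG : planar G R.

Lemma edge_ends (e : edge G) (x y : G) : x \in val e -> y \in val e -> x != y ->
  val e = [set x; y]%SET /\ adj x y.
Proof.
have := valP e; rewrite inE => /existsP[u /existsP[v /andP[uv /eqP ->]]].
rewrite !inE => /orP[]/eqP -> /orP[]/eqP ->; rewrite ?eqxx // => _.
by rewrite finset.setUC adj_sym.
Qed.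

(** Only uniform distance bounds are kept from the plane drawing. Arcs may share ends, but outside
    the balls of radius [r] at the vertices they are disjoint compact sets and hence separated. *)
Record metric_drawing := MetricDrawing {
  mpt : G -> R * R;
  marc : edge G -> R -> R * R;
  msrc : edge G -> G;
  mtgt : edge G -> G;
  m_ends : forall e, val e = [set msrc e; mtgt e]%SET;
  m_adj : forall e, adj (msrc e) (mtgt e);
  m_src : forall e, marc e 0 = mpt (msrc e);
  m_tgt : forall e, marc e 1 = mpt (mtgt e);
  m_vertex : exists2 r : R, 0 < r & (forall u v, u != v -> ~ ball (mpt u) r (mpt v)) /\
    (forall (e : edge G) v (t : R), v \notin val e -> 0 <= t <= 1 -> ~ ball (mpt v) r (marc e t));
  m_edges : forall r : R, 0 < r -> exists2 d : R, 0 < d & forall (e e' : edge G) (t t' : R), e != e' ->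
    0 <= t <= 1 -> 0 <= t' <= 1 -> (forall v, ~ ball (mpt v) r (marc e t)) ->
    (forall v, ~ ball (mpt v) r (marc e' t')) -> ~ ball (marc e t) d (marc e' t');
  m_cont : forall d : R, 0 < d -> exists2 c : R, 0 < c & forall e (s t : R), 0 <= s <= 1 -> 0 <= t <= 1 ->
    `|s - t| < c -> ball (marc e s) d (marc e t) }.

Lemma metric_drawing_exists : inhabited metric_drawing.
Proof.
have [p [a [pinj arcs out disj]]] := planarG.
have I0 : (0 : R) \in `[0, 1] by rewrite in_itv /= lexx ler01.
have I1 : (1 : R) \in `[0, 1] by rewrite in_itv /= lexx ler01.
have /fin_all_exists[s hs] : forall e, exists s : G * G,
    [/\ val e = [set s.1; s.2]%SET, adj s.1 s.2, a e 0 = p s.1 & a e 1 = p s.2].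
  move=> e; have [ca ia ends] := arcs e.
  have [x xe px] : (p @` [set x | x \in val e]) (a e 0) by rewrite -ends; left.
  have [y ye py] : (p @` [set x | x \in val e]) (a e 1) by rewrite -ends; right.
  have xy : x != y.
    apply/eqP => xy; have : a e 0 = a e 1 by rewrite -px -py xy.
    by move/(ia _ _ I0 I1)/eqP; rewrite eq_sym oner_eq0.
  by have [h1 h2] := edge_ends xe ye xy; exists (x, y).
have cimg e : compact (a e @` `[0, 1]).
  by apply: continuous_compact; [have [] := arcs e | exact: segment_compact].
have interior (e : edge G) (t : R) : 0 <= t <= 1 -> (forall v : G, v \in val e -> a e t <> p v) -> t \in `]0, 1[.
  move=> /andP[t0 t1] nv; have [ve _ h0 h1] := hs e; rewrite /= in_itv /=.
  rewrite !lt_neqAle t0 t1 !andbT; apply/andP; split; apply/eqP => tE.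
    by apply: (nv (s e).1); rewrite ?ve ?inE ?eqxx // -tE.
  by apply: (nv (s e).2); rewrite ?ve ?inE ?eqxx ?orbT // tE.
have noedge (e : edge G) (v : G) (t : R) : v \notin val e -> 0 <= t <= 1 -> a e t <> p v.
  move=> ve tI atv; apply: (out e v); exists t => //.
  by apply: (interior e) => // u ue; rewrite atv => /pinj vu; rewrite vu ue in ve.
have [r1 r10 hr1] : exists2 r : R, 0 < r & forall uv : G * G, uv.1 != uv.2 -> ~ ball (p uv.1) r (p uv.2).
  apply: finite_uniform => [[u v] e e' ee' /= h uv b|[u v] /=].
    by apply: (h uv); apply: le_ball b.
  case: (eqVneq u v) => [_|uv]; first by exists 1.
  have [||e e0 h] := @compact_closed_separated R _ [set p u] [set p v] (@compact_set1 _ _).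
  - exact: (compact_closed (@norm_hausdorff _ _) (@compact_set1 _ _)).
  - by apply/seteqP; split=> // x [/= -> /pinj e]; rewrite e eqxx in uv.
  by exists e => // _; apply: h.
have [r2 r20 hr2] : exists2 r : R, 0 < r & forall ev : edge G * G, ev.2 \notin val ev.1 ->
    forall t : R, 0 <= t <= 1 -> ~ ball (p ev.2) r (a ev.1 t).
  apply: finite_uniform => [[e v] d d' dd' /= h ve t tI b|[e v] /=].
    by apply: (h ve t tI); apply: le_ball b.
  case: (boolP (v \in val e)) => [_|ve]; first by exists 1.
  have [||d d0 h] := @compact_closed_separated R _ [set p v] (a e @` `[0, 1]) (@compact_set1 _ _).
  - exact: (compact_closed (@norm_hausdorff _ _) (cimg e)).
  - apply/seteqP; split=> // x [/= -> [t tI]]; apply: noedge => //.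
  by exists d => // _ t tI; apply: h => //; exists t => //=.
have hcont (d : R) : 0 < d -> exists2 c : R, 0 < c & forall e (s t : R), 0 <= s <= 1 -> 0 <= t <= 1 ->
    `|s - t| < c -> ball (a e s) d (a e t).
  move=> d0; apply: finite_uniform => [e c c' cc' h s0 t sI tI st|e].
    by apply: h => //; apply: lt_le_trans st cc'.
  have [ca _ _] := arcs e.
  by have [c c0 h] := arc_uniform_continuity ca d0; exists c.
have hedges (r : R) : 0 < r -> exists2 d : R, 0 < d & forall (e e' : edge G) (t t' : R), e != e' ->
    0 <= t <= 1 -> 0 <= t' <= 1 -> (forall v, ~ ball (p v) r (a e t)) ->
    (forall v, ~ ball (p v) r (a e' t')) -> ~ ball (a e t) d (a e' t').
  move=> r0.
  pose K e := a e @` `[0, 1] `&` [set x | forall v, ~ ball (p v) r x].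
  have cK e : compact (K e).
    apply: (subclosed_compact _ (cimg e)); last by move=> x [].
    apply: closedI; first exact: (compact_closed (@norm_hausdorff _ _) (cimg e)).
    have -> : [set x | forall v, ~ ball (p v) r x] = \bigcap_v ~` ball (p v) r.
      by apply/seteqP; split=> x /= h v; [move=> _|]; apply: h.
    by apply: closed_bigI => v _; apply: open_closedC; apply: ball_open.
  suff [d d0 h] : exists2 d : R, 0 < d & forall ee : edge G * edge G, ee.1 != ee.2 ->
      forall x y, K ee.1 x -> K ee.2 y -> ~ ball x d y.
    exists d => // e e' t t' ee' tI t'I ht ht'; apply: (h (e, e') ee').
      by split=> //; exists t; rewrite //= in_itv.
    by split=> //; exists t'; rewrite //= in_itv.
  apply: finite_uniform => [[e e'] d d' dd' /= h ee' x y Kx Ky b|[e e'] /=].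
    by apply: (h ee' x y Kx Ky); apply: le_ball b.
  case: (eqVneq e e') => [_|ee']; first by exists 1.
  have [||d d0 h] := @compact_closed_separated R _ (K e) (K e') (cK e).
  - exact: (compact_closed (@norm_hausdorff _ _) (cK e')).
  - apply/seteqP; split=> // x [[[t tI tx] hx] [[t' t'I t'x] _]].
    have inn (e1 : edge G) (t1 : R) : t1 \in `[0, 1] -> a e1 t1 = x -> t1 \in `]0, 1[.
      rewrite /= in_itv /= => t1I t1x; apply: (interior e1) => // v _ h; apply: (hx v).
      by rewrite -t1x h; apply: ballxx.
    have : (a e @` `]0, 1[ `&` a e' @` `]0, 1[) x.
      by split; [exists t | exists t'] => //; [apply: (inn e)|apply: (inn e')].
    by rewrite disj.
  by exists d => // _ x y; apply: h.
apply: inhabits; apply: (@MetricDrawing p a (fun e => (s e).1) (fun e => (s e).2)) => //.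
- by move=> e; have [] := hs e.
- by move=> e; have [] := hs e.
- by move=> e; have [] := hs e.
- by move=> e; have [] := hs e.
exists (Num.min r1 r2); first by rewrite lt_min r10.
split=> [u v uv b|e v t ve tI b].
  by apply: (hr1 (u, v) uv); apply: le_ball b; rewrite ge_min lexx.
by apply: (hr2 (e, v) ve t tI); apply: le_ball b; rewrite ge_min lexx orbT.
Qed.
End Drawing.

(** Take the last index at which [P] holds, then the first later one at which [Q] holds. *)
Lemma trim_walk (P Q : pred nat) n : P 0%N -> Q n -> (forall i, P i -> ~~ Q i) ->
  exists ij : nat * nat, [/\ (ij.1 < ij.2 <= n)%N, P ij.1, Q ij.2 &
    forall i, (ij.1 < i < ij.2)%N -> ~~ P i && ~~ Q i].
Proof.
move=> P0 Qn PQ.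
have exP : exists i, (i <= n)%N && P i by exists 0%N.
have ubP i : (i <= n)%N && P i -> (i <= n)%N by case/andP.
case: (ex_maxnP exP ubP) => i /andP[ile Pi] imax.
have exQ : exists j, (i <= j)%N && Q j by exists n; rewrite ile.
case: (ex_minnP exQ) => j /andP[ij Qj] jmin.
have jn : (j <= n)%N by apply: jmin; rewrite ile.
have ltij : (i < j)%N.
  by rewrite ltn_neqAle ij andbT; apply: contraTneq Pi => ->; apply: contraL Qj; apply: PQ.
exists (i, j); split=> //=; first by rewrite ltij.
move=> l /andP[il lj]; apply/andP; split.
  apply/negP => Pl; have := imax l; rewrite Pl (leq_trans (ltnW lj) jn) => /(_ isT).
  by rewrite leqNgt il.
by apply/negP => Ql; have := jmin l; rewrite Ql (ltnW il) => /(_ isT); rewrite leqNgt lj.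
Qed.

(** * Squares and rounding in the grid *)

Section GridSquares.
Local Open Scope ring_scope.

Definition int_range (x : int) (n : nat) : seq int := [seq x + i%:Z | i <- iota 0 n].

Lemma mem_int_range x n y : (y \in int_range x n) = (x <= y < x + n%:Z).
Proof.
apply/mapP/idP => [[i]|h]; first by rewrite mem_iota => /= h ->; lia.
by exists `|y - x|%N; [rewrite mem_iota; lia | lia].
Qed.

Lemma int_range_uniq x n : uniq (int_range x n).
Proof. by rewrite map_inj_uniq ?iota_uniq // => i j; lia. Qed.

Definition square (c : int * int) (s : nat) : seq (int * int) :=
  [seq (x, y) | x <- int_range (c.1 - s%:Z) (2 * s + 1), y <- int_range (c.2 - s%:Z) (2 * s + 1)].

Lemma mem_square c s z : (z \in square c s) =
  [&& c.1 - s%:Z <= z.1, z.1 <= c.1 + s%:Z, c.2 - s%:Z <= z.2 & z.2 <= c.2 + s%:Z].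
Proof.
apply/allpairsP/idP => [[[x y] [/=]]|h].
  by rewrite !mem_int_range => h1 h2 -> /=; lia.
exists z; rewrite !mem_int_range; split; [lia|lia|by case: z h].
Qed.

Lemma square_uniq c s : uniq (square c s).
Proof. by apply: allpairs_uniq; rewrite ?int_range_uniq // => -[? ?] [? ?] _ _ [-> ->]. Qed.

Lemma step_fst (z z' : int * int) : z.1 - 1 <= z'.1 <= z.1 + 1 -> step z (z'.1, z.2).
Proof. by case: z z' => x y [x' y'] /=; rewrite /step !inE -!pair_eqE /pair_eq /=; lia. Qed.

Lemma step_snd (z z' : int * int) : z.2 - 1 <= z'.2 <= z.2 + 1 -> step (z'.1, z.2) z'.
Proof. by case: z z' => x y [x' y'] /=; rewrite /step !inE -!pair_eqE /pair_eq /=; lia. Qed.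

Lemma center_square c s : c \in square c s.
Proof. by case: c => x y; rewrite mem_square /=; lia. Qed.

Lemma square_seg c s z z' : z \in square c s ->
  in_seg (c, (c.1, z.2)) z' || in_seg ((c.1, z.2), z) z' -> z' \in square c s.
Proof.
by case: c z z' => x y [z1 z2] [w1 w2]; rewrite !mem_square /in_seg /=; lia.
Qed.
End GridSquares.

Section Floor.
Local Open Scope ring_scope.

Lemma floor_bounds (R : realType) (a : R) : (Num.floor a)%:~R <= a < (Num.floor a)%:~R + 1.
Proof. by have := floor_itv a; rewrite intrD. Qed.
End Floor.

Section Rounding.
Local Open Scope ring_scope.
Variables (R : realType) (N : R).
Implicit Types (x y : R * R) (z : int * int).

Definition close (k : R) z x :=
  (`|z.1%:~R - N * x.1| <= k) && (`|z.2%:~R - N * x.2| <= k).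
Definition round x : int * int := (Num.floor (N * x.1), Num.floor (N * x.2)).

Lemma round_close x : close 1 (round x) x.
Proof.
rewrite /close /round /= !ler_norml.
have /andP[? ?] := floor_bounds (N * x.1); have /andP[? ?] := floor_bounds (N * x.2).
by apply/andP; split; apply/andP; split; lra.
Qed.

Lemma floor_near (a b : R) : `|a - b| < 1 -> (Num.floor a - 1 <= Num.floor b <= Num.floor a + 1).
Proof.
have /andP[? ?] := floor_bounds a; have /andP[? ?] := floor_bounds b.
rewrite ltr_norml => /andP[? ?].
have h1 : (Num.floor a)%:~R < (Num.floor b + 2)%:~R :> R by rewrite intrD; lra.
have h2 : (Num.floor b)%:~R < (Num.floor a + 2)%:~R :> R by rewrite intrD; lra.
by rewrite !ltr_int in h1 h2; lia.
Qed.

Lemma square_close x z (s : nat) : z \in square (round x) s -> close (s%:R + 1) z x.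
Proof.
rewrite mem_square -!(ler_int R) !(intrB, intrD) -!pmulrn => /and4P[? ? ? ?].
have /andP[] := round_close x; rewrite !ler_norml => /andP[? ?] /andP[? ?].
by rewrite /close !ler_norml; apply/andP; split; apply/andP; split; lra.
Qed.

Lemma close_square x z (s : nat) : close s%:R z x -> z \in square (round x) s.+1.
Proof.
move=> /andP[]; rewrite !ler_norml => /andP[? ?] /andP[? ?].
have /andP[] := round_close x; rewrite !ler_norml => /andP[? ?] /andP[? ?].
by rewrite mem_square -!(ler_int R) !(intrB, intrD) -!pmulrn -natr1; apply/and4P; split; lra.
Qed.
Lemma close_step k z z' x : step z z' -> close k z x -> close (k + 1) z' x.
Proof.
move=> zz /andP[]; rewrite /close !ler_norml => /andP[? ?] /andP[? ?].
by case/orP: zz => [/eqP ->|/nbrsP[] ->]; rewrite ?intrD ?intrB /=;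
  apply/andP; split; apply/andP; split; lra.
Qed.

(** Successive samples may round to diagonal neighbours; this corner, reached by changing the first
    coordinate first, is inserted between them. *)
Lemma close_corner x y : `|N * x.1 - N * y.1| < 1 -> close 2 ((round y).1, (round x).2) x.
Proof.
have /andP[+ _] := round_close y; have /andP[_ +] := round_close x.
rewrite /close /= !ltr_norml !ler_norml => /andP[? ?] /andP[? ?] /andP[? ?].
by apply/andP; split; apply/andP; split; lra.
Qed.

Hypothesis N0 : 0 < N.

Lemma close_ball k l e z x y : close k z x -> close l z y -> k + l < N * e -> ball x e y.
Proof.
have sc (a b c : R) : `|c - N * a| <= k -> `|c - N * b| <= l -> k + l < N * e -> `|a - b| < e.
  move=> h1 h2 h3; rewrite -(ltr_pM2l N0) -[X in X * `|_|](gtr0_norm N0) -normrM mulrBr.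
  move: h1 h2; rewrite !ler_norml ltr_norml => /andP[? ?] /andP[? ?]; by apply/andP; split; lra.
move=> /andP[x1 x2] /andP[y1 y2] kl.
by split; rewrite -ball_normE /=; [apply: sc x1 y1 kl | apply: sc x2 y2 kl].
Qed.

Lemma ball_scale x y e : ball x e y ->
  `|N * x.1 - N * y.1| < N * e /\ `|N * x.2 - N * y.2| < N * e.
Proof.
by case; rewrite -!ball_normE /= => h1 h2; rewrite -!mulrBr !normrM (gtr0_norm N0) !ltr_pM2l.
Qed.

Lemma close_move k e z x y : close k z x -> ball x e y -> close (k + N * e) z y.
Proof.
move=> /andP[] + + /ball_scale[]; rewrite /close !ler_norml !ltr_norml.
move=> /andP[? ?] /andP[? ?] /andP[? ?] /andP[? ?].
by apply/andP; split; apply/andP; split; lra.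
Qed.

End Rounding.

(** * Discretising the drawing *)

Section FromMetric.
Local Open Scope ring_scope.
Variables (R : realType) (G : sgraph) (d : metric_drawing R G).
Notation p := (@mpt R G d). Notation arc := (@marc R G d).
Notation src := (@msrc R G d). Notation tgt := (@mtgt R G d).

Lemma grid_drawing_exists : inhabited (grid_drawing src tgt).
Proof.
have [r0 r00 [sep_vv sep_ve]] := m_vertex d.
(* The factor 8 keeps the boxes, with rounding errors, away from each other and from arcs not ending
   there. *)
pose r := r0 / 8; have rpos : 0 < r by rewrite divr_gt0.
have [eta eta0 sep_ee] := m_edges d (divr_gt0 rpos (ltr0n _ 2)).
(* In grid units the boxes have radius about [N * r > 20] and distinct arcs a gap [N * eta > 8],
   well above the rounding error 2 of a walk. *)
pose N : R := (Num.truncn (20 / r + 8 / eta)).+1%:R.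
have N0 : 0 < N by rewrite ltr0n.
have Nbig : 20 / r + 8 / eta < N.
  have h0 : 0 <= 20 / r + 8 / eta by rewrite addr_ge0 ?divr_ge0 ?ltW.
  by have /andP[_] := truncn_itv h0.
have Nr : 20 < N * r.
  rewrite -ltr_pdivrMr //; apply: le_lt_trans Nbig; rewrite lerDl divr_ge0 //; exact: ltW.
have Neta : 8 < N * eta.
  rewrite -ltr_pdivrMr //; apply: le_lt_trans Nbig; rewrite lerDr divr_ge0 //; exact: ltW.
have Nr0 : N * r0 = 8 * (N * r) by rewrite /r; lra.
have [c c0 ucont] := m_cont d (divr_gt0 ltr01 N0).
pose M := (Num.truncn c^-1).+1.
have Mpos : 0 < M%:R :> R by rewrite ltr0n.
have Mc : M%:R^-1 < c.
  rewrite invf_plt ?posrE //; have ci : 0 <= c^-1 by rewrite invr_ge0 ltW.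
  by have /andP[_] := truncn_itv ci.
pose s := (Num.truncn (N * r)).-1.
have /andP[sr1 sr2] : s.+1%:R <= N * r < s.+2%:R.
  have h0 : 0 <= N * r by lra.
  have := truncn_itv h0; rewrite /s prednK // truncn_gt0; lra.
have sr : N * r - 2 < s%:R by rewrite -!natr1 in sr2; lra.
pose box v := square (round N (p v)) s.+1.
have close_le k l z x : k <= l -> close N k z x -> close N l z x.
  by move=> kl /andP[h1 h2]; rewrite /close !(le_trans _ kl).
have box_close v z : z \in box v -> close N (N * r + 1) z (p v).
  by move/square_close; apply: close_le; lra.
(* A walk point outside the box of [v] stems from an arc point outside the ball of radius [r / 2],
   as [sep_ee] requires. *)
have box_far v z x : z \notin box v -> close N 2 z x -> ~ ball (p v) (r / 2) x.
  move=> zv zx /ball_sym b; move/negP: zv; apply.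
  by apply: close_square; apply: close_le (close_move N0 zx b); lra.
have box_disj u v z : z \in box u -> z \in box v -> u = v.
  move=> zu zv; case: (eqVneq u v) => // uv; case: (sep_vv u v uv).
  by apply: (close_ball N0 (box_close u z zu) (box_close v z zv)); lra.
pose q e i := round N (arc e (i%:R / M%:R)).
(* Even indices give rounded samples, odd ones the corners between them. *)
pose W e j := if odd j then ((q e j./2.+1).1, (q e j./2).2) else q e j./2.
have tI i : (i <= M)%N -> 0 <= (i%:R / M%:R : R) <= 1.
  move=> iM; apply/andP; split; first by rewrite divr_ge0 ?ler0n.
  by rewrite ler_pdivrMr // mul1r ler_nat.
have near_step e i : (i < M)%N -> ball (arc e (i%:R / M%:R)) (1 / N) (arc e (i.+1%:R / M%:R)).
  move=> iM; apply: ucont; [exact: tI (ltnW iM)|exact: tI|].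
  rewrite -mulrBl -natr1 opprD addrA subrr sub0r mulN1r normrN ger0_norm //.
have NN : N * (1 / N) = 1 by rewrite mul1r mulfV // gt_eqF.
have W_close e j : (j <= M.*2)%N -> close N 2 (W e j) (arc e (j./2%:R / M%:R)).
  move=> jM; rewrite /W; case: ifP => oj; last first.
    by apply: close_le (round_close N _); lra.
  have jl : (j./2 < M)%N.
    rewrite ltn_half_double ltn_neqAle jM andbT.
    by apply: contraTneq oj => ->; rewrite odd_double.
  apply: (@close_corner _ N (arc e (j./2%:R / M%:R)) (arc e (j./2.+1%:R / M%:R))).
  by have [h _] := ball_scale N0 (near_step e _ jl); rewrite NN in h.
have W_step e j : (j < M.*2)%N -> step (W e j) (W e j.+1).
  move=> jM; have jl : (j./2 < M)%N by rewrite ltn_half_double.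
  have [] := ball_scale N0 (near_step e _ jl); rewrite NN.
  move=> /floor_near h1 /floor_near h2; rewrite /W /= uphalf_half; case: (odd j) => /=.
    by rewrite add1n; apply: (@step_snd (q e j./2) (q e j./2.+1) h2).
  by rewrite add0n; apply: (@step_fst (q e j./2) (q e j./2.+1) h1).
have in_box v : round N (p v) \in box v.
  exact: center_square.
have Mne : M%:R != 0 :> R by rewrite gt_eqF.
have W0 e : W e 0 \in box (src e) by rewrite /W /= /q mul0r m_src.
have WM e : W e M.*2 \in box (tgt e).
  by rewrite /W odd_double doubleK /q divff // m_tgt.
have st e : src e != tgt e by apply: contraTneq (m_adj d e) => ->; rewrite adj_irr.
have /fin_all_exists[ij hij] : forall e : edge G, exists ij : nat * nat,
    [/\ (ij.1 < ij.2 <= M.*2)%N, W e ij.1 \in box (src e), W e ij.2 \in box (tgt e) &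
      forall i, (ij.1 < i < ij.2)%N -> (W e i \notin box (src e)) && (W e i \notin box (tgt e))].
  move=> e; apply: (@trim_walk (fun j => W e j \in box (src e)) (fun j => W e j \in box (tgt e))) => //.
  by move=> i Ws; apply: contra (st e) => Wt; apply/eqP; apply: box_disj Ws Wt.
pose len e := ((ij e).2 - (ij e).1)%N.
pose walk e i := W e ((ij e).1 + i)%N.
have idx e i : (i <= len e)%N -> ((ij e).1 + i <= M.*2)%N.
  have [/andP[h1 h2] _ _ _] := hij e; rewrite /len => il.
  by apply: leq_trans h2; rewrite -leq_subRL // ltnW.
have tI2 j : (j <= M.*2)%N -> 0 <= (j./2%:R / M%:R : R) <= 1.
  by move=> jM; apply: tI; rewrite leq_half_double leqW.
have out e i v : (0 < i < len e)%N -> walk e i \notin box v.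
  move=> /andP[i0 il]; have [_ _ _ hout] := hij e.
  have /andP[os ot] : (walk e i \notin box (src e)) && (walk e i \notin box (tgt e)).
    apply: hout; rewrite -ltn_subRL il andbT -[X in (X < _)%N]addn0 ltn_add2l; exact: i0.
  case: (boolP (v \in val e)) => ve.
    by move: ve; rewrite (m_ends d e) !inE => /orP[]/eqP ->.
  apply/negP => wv; have iM := idx e i (ltnW il).
  apply: (sep_ve e v _ ve (tI2 _ iM)).
  by apply: (close_ball N0 (box_close _ _ wv) (W_close e _ iM)); lra.
apply: inhabits; apply: (@GridDrawing _ _ src tgt box (fun v => round N (p v)) len walk) => //.
- by move=> v; apply: square_uniq.
- by move=> v z z'; apply: square_seg.
- by move=> e; rewrite /walk addn0; have [] := hij e.
- by move=> e; rewrite /walk /len subnKC; have [/andP[/ltnW]] := hij e.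
- move=> e; have [/andP[h1 h2] ws wt _] := hij e.
  have l0 : (0 < len e)%N by rewrite /len subn_gt0.
  rewrite ltn_neqAle l0 andbT eq_sym; apply/eqP => l1.
  have e2 : (ij e).2 = (ij e).1.+1 by move: h1 l1; rewrite /len; clear; lia.
  have wst : step (W e (ij e).1) (W e (ij e).2) by rewrite e2; apply: W_step; rewrite -e2.
  apply: (sep_vv _ _ (st e)).
  have cs := box_close _ _ ws; have ct := box_close _ _ wt.
  have cs' : close N (N * r + 2) (W e (ij e).2) (p (src e)).
    by apply: close_le (close_step wst cs); lra.
  by apply: (close_ball N0 cs' ct); lra.
- move=> e i il; rewrite /walk addnS; apply: W_step.
  by have := idx e i.+1 il; rewrite addnS.
(* A common grid point would bring the two arcs within [eta] of each other outside the balls at the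
   vertices. *)
move=> e e' i j il jl zz; apply/eqP; apply/negPn/negP => ee'.
have iM : ((ij e).1 + i <= M.*2)%N by apply: idx; case/andP: il => _ /ltnW.
have jM : ((ij e').1 + j <= M.*2)%N by apply: idx; case/andP: jl => _ /ltnW.
apply: (sep_ee e e' _ _ ee' (tI2 _ iM) (tI2 _ jM)).
- by move=> v; apply: box_far (out e i v il) _; apply: W_close.
- by move=> v; apply: box_far (out e' j v jl) _; apply: W_close.
have cj := W_close e' _ jM; rewrite -/(walk e' j) -zz in cj.
by apply: (close_ball N0 (W_close e _ iM) cj); lra.
Qed.
End FromMetric.

(** * The strong chromatic index *)

Section StrongIndex.
Variable G : sgraph.

Lemma deg_le_maxdeg (x : G) : deg x <= maxdeg G.
Proof. exact: leq_bigmax. Qed.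

Lemma deg_le_sigma (x y : G) : adj x y -> deg x + deg y <= (sigma G).+1.
Proof.
move=> xy; have := @leq_bigmax_cond _ (fun p : G * G => adj p.1 p.2)
  (fun p => deg p.1 + deg p.2 - 1) (x, y) xy.
by rewrite /= -/(sigma G); lia.
Qed.

Lemma sigma_attained : 0 < sigma G -> exists x y : G, adj x y /\ sigma G = deg x + deg y - 1.
Proof.
move=> s0; pose A := [pred p : G * G | adj p.1 p.2].
have cA : 0 < #|A|.
  apply: contraTltn s0; rewrite leqn0 => /eqP/card0_eq A0.
  by rewrite /sigma big1 // => p pA; have := A0 p; rewrite inE pA.
have [[x y] xy e] := @eq_bigmax_cond _ A (fun p => deg p.1 + deg p.2 - 1) cA.
by exists x, y.
Qed.

Lemma edge_of_adj (x y : G) : adj x y -> exists e : edge G, val e = [set x; y]%SET.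
Proof.
move=> xy; have xyE : [set x; y]%SET \in edges G.
  by rewrite inE; apply/existsP; exists x; apply/existsP; exists y; rewrite xy eqxx.
by exists (Sub [set x; y]%SET xyE); rewrite SubK.
Qed.

Lemma edge_other (e : edge G) (x : G) : x \in val e -> exists2 y, val e = [set x; y]%SET & adj x y.
Proof.
have := valP e; rewrite inE => /existsP[u /existsP[v /andP[uv /eqP ->]]].
rewrite !inE => /orP[]/eqP ->; first by exists v.
by exists u; rewrite 1?adj_sym // finset.setUC.
Qed.

Lemma edge_vertices (e : edge G) (x y : G) : val e = [set x; y]%SET -> x \in val e /\ y \in val e.
Proof. by move=> ->; rewrite !inE !eqxx orbT. Qed.

Lemma deg_le_incident (x : G) : deg x <= #|[set e : edge G | x \in val e]%SET|.
Proof.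
have /fin_all_exists[oth hoth] : forall e : edge G, exists y, x \in val e -> val e = [set x; y]%SET.
  move=> e; case: (boolP (x \in val e)) => [/edge_other[y ? _]|_]; last by exists x.
  by exists y.
apply: leq_trans (leq_imset_card oth _); apply: subset_leq_card; apply/fintype.subsetP => y.
rewrite inE => xy; have [e ve] := edge_of_adj xy; have [xe ye] := edge_vertices ve.
apply/imsetP; exists e; rewrite ?inE //.
have := hoth e xe; rewrite ve => /setP/(_ y); rewrite !inE eqxx orbT => /esym/orP[]/eqP // yx.
by rewrite yx adj_irr in xy.
Qed.

Lemma sigma_le_colors k : 0 < sigma G -> strong_colorable G k -> sigma G <= k.
Proof.
case/sigma_attained => x [y [xy ->]] /existsP[f /forallP hf].
pose Sx := [set e : edge G | x \in val e]%SET; pose Sy := [set e : edge G | y \in val e]%SET.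
have fi : {in Sx :|: Sy &, injective f}%SET.
  move=> e1 e2; rewrite !inE => h1 h2 /eqP; apply: contraTeq => ne.
  have /forallP/(_ e2)/implyP := hf e1; apply; rewrite ne /=.
  have yx : adj y x by rewrite adj_sym.
  by case/orP: h1 => h1; case/orP: h2 => h2; apply/exists_inP; eexists; try exact: h1;
    apply/exists_inP; eexists; try exact: h2; rewrite ?eqxx ?xy ?yx ?orbT.
have := card_in_imset fi; have := max_card [set f e | e in (Sx :|: Sy)%SET]%SET.
rewrite card_ord => h1 h2; rewrite h2 in h1; apply: leq_trans h1.
rewrite cardsU leq_sub ?leq_add ?deg_le_incident //.
(* The stars of [x] and [y] share only the edge between them, which accounts for the subtracted
   1. *)
apply/card_le1_eqP => e1 e2; rewrite !inE => /andP[x1 y1] /andP[x2 y2].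
have nxy : x != y by apply: contraTneq xy => ->; rewrite adj_irr.
have [] := edge_ends x1 y1 nxy; have [] := edge_ends x2 y2 nxy => v2 _ v1 _.
by apply: val_inj; rewrite /= v1 v2.
Qed.

Lemma strong_colorable_of_pairs k (c : G -> G -> 'I_k) :
  strong_pair_coloring (@adj G) c -> strong_colorable G k.
Proof.
move=> hc; have [sc cP] := hc.
have /fin_all_exists[s hs] : forall e : edge G, exists s : G * G,
    val e = [set s.1; s.2]%SET /\ adj s.1 s.2.
  move=> e; have := valP e; rewrite inE => /existsP[u /existsP[v /andP[uv /eqP ve]]].
  by exists (u, v).
apply/existsP; exists [ffun e => c (s e).1 (s e).2].
apply/forallP => e1; apply/forallP => e2; apply/implyP => /andP[ne].
case/exists_inP => x xe1 /exists_inP[y ye2 xy]; rewrite !ffunE.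
have colE (e : edge G) (z : G) : z \in val e -> exists t, [/\ adj z t, val e = [set z; t]%SET & c (s e).1 (s e).2 = c z t].
  have [ve ae] := hs e; rewrite ve !inE => /orP[]/eqP ->; first by exists (s e).2.
  by exists (s e).1; rewrite adj_sym finset.setUC.
have [x' [xx' v1 ->]] := colE e1 x xe1; have [y' [yy' v2 ->]] := colE e2 y ye2.
apply: contra ne => /eqP cc; apply/eqP/val_inj; rewrite /= v1 v2.
case/orP: xy => [/eqP xy|xy].
  by subst y; rewrite (strong_pair_inj (@adj_sym G) hc xx' yy' cc).
by have [-> ->] := cP x y x' y' xy xx' yy' cc; rewrite finset.setUC.
Qed.
End StrongIndex.

Theorem theorem11 (R : realType) (G : sgraph)
  (G_planar : planar G R)
  (sigma_ge5 : (5 <= sigma G)%N)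
  (sigma_ge_maxdeg : (maxdeg G + 2 <= sigma G)%N)
  (girth_ge : ((((5 * sigma G + 16)%N)%:R)%:E <= girth G R)%E) :
  strong_chromatic_index G = sigma G.
Proof.
have [d] := metric_drawing_exists G_planar.
have [g] := grid_drawing_exists d.
have colorable : strong_colorable G (sigma G).
  have [|||c hc] := @strong_coloring_of_threads G (sigma G) (@adj G) sigma_ge5 (@adj_sym G) (@adj_irr G).
  - by move=> x; apply: leq_trans sigma_ge_maxdeg; rewrite leq_add2r deg_le_maxdeg.
  - exact: deg_le_sigma.
  - apply: (has_threads_of_drawing (@adj_irr G) (m_adj d) _ _ g) => //.
    + move=> x y xy; have [e ve] := edge_of_adj xy; exists e.
      have [se te] := edge_vertices (m_ends d e).
      have := m_adj d e; move: se te; rewrite ve !inE.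
      by do 2![case/orP => /eqP ->]; rewrite ?adj_irr //; [left|right].
    + move=> e e' /= ee; apply: val_inj; by rewrite /= (m_ends d e) (m_ends d e') ee.
    move=> c sc uc.
    have : (((5 * sigma G + 16)%N)%:R%:E <= ((size c)%:R)%:E :> \bar R)%E.
      apply: (le_trans girth_ge); apply: ereal_inf_lbound; exists c => //=.
      by rewrite /is_cycle sc.
    (* For [n = sigma G + 3], the bound [5 * n < size c] means [5 * sigma G + 16 <= size c]. *)
    by rewrite lee_fin ler_nat; lia.
  exact: strong_colorable_of_pairs hc.
rewrite /strong_chromatic_index; case: ex_minnP => k kc kmin.
apply/eqP; rewrite eqn_leq kmin //= sigma_le_colors //.
exact: leq_trans sigma_ge5.
Qed.
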